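(* Let $d_1,d_2$ be positive integers with $d_1\equiv d_2\pmod 2$ and $d_2>d_1$. Then $$\begin{aligned}\mathcal{PI}_{d_1,d_2}(z)=\Psi_{1,d_2}\bigl((1-z^2)F(t,z)\bigr)=&\sum_{d_1/2\le k\le d_1}\varphi_{2k-d_1}\bigl((1-z^2)A_k(z)\bigr)+\sum_{d_1/2\le k\le d_1}\Bigl(z\,\varphi_{2k-d_1}\bigl((1-z^2)B_k(z)\bigr)\Bigr)'_z\\&+\sum_{0\le 2k\le d_2-d_1-2}\varphi_{d_2-2k}\bigl((1-z^2)C_k(z)\bigr)+\sum_{d_1+d_2+2\le 2k\le 2d_2}\varphi_{d_2-2k}\bigl((1-z^2)C_k(z)\bigr),\end{aligned}$$ where $\varphi_m:=0$ for $m<0$ and $$F(t,z)=f_{d_1,d_2}(tz^{d_2},z)=\frac{1}{\prod_{j=0}^{d_1}(1-tz^{d_2-d_1+2j})\prod_{j=0}^{d_2}(1-tz^{2j})},$$ $$A_k(z)=-\frac{1}{z^{d_2+d_1-2k}}\lim_{t\to z^{2k-(d_1+d_2)}}\frac{\partial}{\partial t}\Bigl(F(t,z)(1-tz^{d_2+d_1-2k})^2\Bigr),$$ $$B_k(z)=\lim_{t\to z^{2k-(d_1+d_2)}}\Bigl(F(t,z)(1-tz^{d_2+d_1-2k})^2\Bigr),\qquad C_k(z)=\lim_{t\to z^{-2k}}\Bigl(F(t,z)(1-tz^{2k})\Bigr).$$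
   Context: All vector spaces are over $\mathbb{C}$. $V_d=\langle v_0,\dots,v_d\rangle$ is the $(d+1)$-dimensional irreducible $\mathfrak{sl}_2$-module with $D_1(v_i)=i\,v_{i-1}$, $D_2(v_i)=(d-i)v_{i+1}$ the actions of $\begin{pmatrix}0&1\\0&0\end{pmatrix}$ and $\begin{pmatrix}0&0\\1&0\end{pmatrix}$, extended by derivations to the symmetric algebra $S(V_{d_1}\oplus V_{d_2})$. The algebra of joint invariants is $\mathcal{I}_{d_1,d_2}=\{v\in S(V_{d_1}\oplus V_{d_2}) : D_1(v)=D_2(v)=0\}$, graded by degree, and its Poincaré series is $\mathcal{PI}_{d_1,d_2}(z)=\sum_{n\ge0}\dim\bigl((\mathcal{I}_{d_1,d_2})_n\bigr)z^n$. $f_{d_1,d_2}(t,z)=\prod_{j=0}^{d_1}(1-tz^{d_1-2j})^{-1}\prod_{j=0}^{d_2}(1-tz^{d_2-2j})^{-1}$. The linear map $\Psi_{m,n}:\mathbb{C}[[t,z]]\to\mathbb{C}[[z]]$ is $\Psi_{m,n}\bigl(\sum_{i,j\ge0}a_{i,j}t^iz^j\bigr)=\sum_{i\ge0}a_{im,in}z^i$. For an integer $n\ge 0$, $\varphi_n:\mathbb{C}[[z]]\to\mathbb{C}[[z]]$ is the linear map $\varphi_n\bigl(\sum_{i\ge0}a_iz^i\bigr)=\sum_{i\ge0}a_{in}z^i$ (so $\varphi_0(\sum a_iz^i)=a_0\sum_{i\ge 0} z^i$). $(\cdot)'_z$ is the derivative in $z$. The limits are evaluations in the field of rational functions: after cancelling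 the factor(s) vanishing at the given value of $t$, substitute this value; the resulting rational functions of $z$ are regular at $z=0$ and are identified with their power series at $z=0$. *)

(* Defs.v *)
From HB Require Import structures.
From mathcomp Require Import all_boot all_order all_algebra.
From mathcomp Require Import zify.
From mathcomp Require Export reals complex mpoly.

Set Implicit Arguments.
Unset Strict Implicit.
Unset Printing Implicit Defensive.

Import GRing.Theory.

Local Open Scope ring_scope.
Local Open Scope quotient_scope.

Local Notation "p %:F" := (FracField.tofrac p) : ring_scope.

(* Rational functions in one variable over a field K, as {fraction {poly K}}. *)

Section RationalFunctions.
Variable K : fieldType.
Implicit Types (r : {fraction {poly K}}) (p q : {poly K}) (a : K).

(* The representative [repr r] is an arbitrary fraction; dividing it by the
   gcd performs the cancellation of common factors. *)
Definition ratnum r : {poly K} :=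
  \n_(repr r) %/ gcdp \n_(repr r) \d_(repr r).
Definition ratden r : {poly K} :=
  \d_(repr r) %/ gcdp \n_(repr r) \d_(repr r).

(* The limit of r at a, meaningful when r has no pole at a. *)
Definition rateval r a : K := (ratnum r).[a] / (ratden r).[a].

Definition ratderiv r : {fraction {poly K}} :=
  ((ratnum r)^`()%:F * (ratden r)%:F - (ratnum r)%:F * (ratden r)^`()%:F)
    / (ratden r)%:F ^+ 2.

(* First n coefficients of the power series p / q, for q`_0 != 0. *)
Fixpoint series_div p q (n : nat) : seq K :=
  if n is m.+1 then
    let s := series_div p q m in
    rcons s ((p`_m - \sum_(i < m) s`_i * q`_(m - i)) / q`_0)
  else [::].

(* The power series of r at 0, meaningful when r has no pole at 0. *)
Definition ratseries r (n : nat) : K :=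
  (series_div (ratnum r) (ratden r) n.+1)`_n.

Lemma tofrac_repr r : r = (\n_(repr r))%:F / (\d_(repr r))%:F.
Proof.
have d0 : (\d_(repr r))%:F != 0 :> {fraction {poly K}}.
  by rewrite tofrac_eq0 denom_ratioP.
apply: (canRL (mulfK d0)); rewrite -[X in X * _]reprK.
unlock FracField.tofrac; rewrite -[LHS]FracField.pi_mul; apply/eqmodP.
rewrite /= FracField.equivfE /FracField.mulf.
rewrite !(numer_Ratio _ (oner_neq0 _)) !(denom_Ratio _ (oner_neq0 _)).
by rewrite !mulr1 !numden_Ratio ?denom_ratioP // mulrC.
Qed.

Lemma ratgcd_neq0 r : gcdp \n_(repr r) \d_(repr r) != 0.
Proof. by rewrite gcdp_eq0 negb_and denom_ratioP orbT. Qed.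

Lemma ratden_neq0 r : ratden r != 0.
Proof.
rewrite divp_eq0 !negb_or ratgcd_neq0 denom_ratioP -leqNgt.
by rewrite dvdp_leq ?denom_ratioP ?dvdp_gcdr.
Qed.

Lemma ratnum_div_ratden r : r = (ratnum r)%:F / (ratden r)%:F.
Proof.
rewrite {1}(tofrac_repr r).
rewrite -[in LHS](divpK (dvdp_gcdl \n_(repr r) \d_(repr r))).
rewrite -[X in _ / X%:F](divpK (dvdp_gcdr \n_(repr r) \d_(repr r))).
by rewrite !tofracM -mulf_div divff ?mulr1 // tofrac_eq0 ratgcd_neq0.
Qed.

Lemma coprimep_ratnum_ratden r : coprimep (ratnum r) (ratden r).
Proof. by rewrite coprimep_div_gcd // denom_ratioP orbT. Qed.

Lemma ratden_dvdp p q : q != 0 -> ratden (p%:F / q%:F) %| q.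
Proof.
move=> q0; set r := _ / _.
have := ratnum_div_ratden r; rewrite {1}/r => /eqP.
rewrite eqr_div ?tofrac_eq0 ?ratden_neq0 // -!tofracM tofrac_eq => /eqP e.
rewrite -(@Gauss_dvdpr _ _ (ratnum r)) 1?coprimep_sym ?coprimep_ratnum_ratden //.
by rewrite -e dvdp_mulIr.
Qed.

Lemma rateval_div p q a : q.[a] != 0 -> rateval (p%:F / q%:F) a = p.[a] / q.[a].
Proof.
move=> qa0; have q0 : q != 0 by apply: contraNneq qa0 => ->; rewrite horner0.
have dv := ratden_dvdp p q0; rewrite /rateval.
set r := _ / _ in dv *.
have da0 : (ratden r).[a] != 0.
  apply: contraNneq qa0 => da; case/dvdpP: dv => c ->.
  by rewrite hornerM da mulr0.
have := ratnum_div_ratden r; rewrite {1}/r => /eqP.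
rewrite eqr_div ?tofrac_eq0 ?ratden_neq0 // -!tofracM tofrac_eq => /eqP e.
by apply/eqP; rewrite eqr_div // -!hornerM e.
Qed.

Lemma size_series_div p q n : size (series_div p q n) = n.
Proof. by elim: n => //= n IHn; rewrite size_rcons IHn. Qed.

Lemma nth_series_div p q n i :
  (i < n)%N -> (series_div p q n)`_i = (series_div p q i.+1)`_i.
Proof.
elim: n => // n IHn; rewrite ltnS leq_eqVlt => /predU1P[-> //|lt_in].
by rewrite -IHn //= nth_rcons size_series_div lt_in.
Qed.

Lemma ratseriesP r : (ratden r)`_0 != 0 ->
  forall n, \sum_(i < n.+1) ratseries r i * (ratden r)`_(n - i) = (ratnum r)`_n.
Proof.
move=> q0 n; rewrite big_ord_recr /= subnn /ratseries {2}/series_div -/series_div.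
rewrite nth_rcons size_series_div ltnn eqxx divfK //.
under eq_bigr => i _ do rewrite -(nth_series_div _ _ (ltn_ord i)).
by rewrite addrC subrK.
Qed.

End RationalFunctions.

(* K(z)(t), the field of rational functions in t and z. *)
Notation ratfun2 K := {fraction {poly {fraction {poly K}}}}.

Section Series.
Variable K : fieldType.

(* K[[z]] is nat -> K, and K[[t,z]] is nat -> nat -> K, the coefficient of
   t^i z^j being a i j. *)

(* Expansion of r in t over K(z), then of each coefficient in z: this is the
   power series of r in K[[t,z]] when r = p / q with q(0,0) != 0. *)
Definition ratseries2 (r : ratfun2 K) (i j : nat) : K :=
  ratseries (ratseries r i) j.

Definition Psi (m n : nat) (a : nat -> nat -> K) (i : nat) : K :=
  a (i * m)%N (i * n)%N.

Definition phi (m : int) (a : nat -> K) (i : nat) : K :=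
  if m is Posz n then a (i * n)%N else 0.

Definition series_mulz (a : nat -> K) (i : nat) : K :=
  if i is j.+1 then a j else 0.

Definition series_deriv (a : nat -> K) (i : nat) : K := i.+1%:R * a i.+1.

End Series.

Section JointInvariants.
Variable K : fieldType.

(* The derivation of the polynomial ring extending the linear map that sends
   the i-th variable to the linear form with coefficients the i-th row of M. *)
Definition derivation_of N (M : 'M[K]_N) (p : {mpoly K[N]}) : {mpoly K[N]} :=
  \sum_i (\sum_j M i j *: 'X_j) * p^`M(i).

Lemma derivation_ofX N (M : 'M[K]_N) i :
  derivation_of M 'X_i = \sum_j M i j *: 'X_j.
Proof.
rewrite /derivation_of (bigD1 i) //= mderivX mnm1E eqxx.
have -> : (U_(i) - U_(i) = 0 :> 'X_{1..N})%MM by rewrite -{1}[U_(i)%MM]add0m addmK.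
rewrite mpolyX0 scale1r mulr1 [X in _ + X]big1 ?addr0 // => k nki.
by rewrite mderivX mnm1E eq_sym (negPf nki) scale0r mulr0.
Qed.

Lemma derivation_ofM N (M : 'M[K]_N) p q :
  derivation_of M (p * q) = derivation_of M p * q + p * derivation_of M q.
Proof.
rewrite /derivation_of mulr_suml mulr_sumr -big_split /=.
by apply: eq_bigr => i _; rewrite mderivM mulrDr mulrA [in RHS]mulrCA.
Qed.

Lemma derivation_of_linear N (M : 'M[K]_N) : linear (derivation_of M).
Proof.
move=> a p q; rewrite /derivation_of scaler_sumr -big_split /=.
by apply: eq_bigr => i _; rewrite linearP mulrDr scalerAr.
Qed.

Lemma derivation_of_homog N (M : 'M[K]_N) n p :
  p \is n.-homog -> derivation_of M p \is n.-homog.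
Proof.
move=> hp; apply: rpred_sum => i _; rewrite mulr_suml; apply: rpred_sum => j _.
rewrite -scalerAl; apply: rpredZ.
case: n hp => [|n] hp.
  suff -> : p^`M(i) = 0 by rewrite mulr0 rpred0.
  apply/mpolyP => m; rewrite mcoeff_deriv mcoeff0.
  rewrite (dhomog_nemf_coeff hp) ?mul0rn //.
  by rewrite mfD /= mdeg1 addn1.
rewrite -add1n; apply: dhomogM; first by rewrite dhomogX /= mdeg1.
apply/dhomogP => m; rewrite mcoeff_msupp mcoeff_deriv => nz.
apply/eqP; rewrite -eqSS -addn1 -(mdeg1 i) -mdegD; apply: contraNT nz => ne.
by rewrite (dhomog_nemf_coeff hp) ?mul0rn.
Qed.

Definition derivation_homog N (M : 'M[K]_N) n (p : dhomog N K n) : dhomog N K n :=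
  DHomog (derivation_of_homog M (dhomog_is_dhomog p)).

Lemma derivation_homog_linear N (M : 'M[K]_N) n :
  linear (@derivation_homog N M n).
Proof. by move=> a p q; apply/val_inj/derivation_of_linear. Qed.

HB.instance Definition _ N (M : 'M[K]_N) n :=
  GRing.isLinear.Build K (dhomog N K n) (dhomog N K n) _
    (@derivation_homog N M n) (@derivation_homog_linear N M n).

(* D_1 and D_2 on V_d, row i holding the coordinates of the image of v_i. *)
Definition D1_irr d : 'M[K]_d.+1 :=
  \matrix_(i, j) (if i == j.+1 :> nat then i%:R else 0).
Definition D2_irr d : 'M[K]_d.+1 :=
  \matrix_(i, j) (if j == i.+1 :> nat then (d - i)%:R else 0).

Definition D1_sum d1 d2 : 'M[K]_(d1.+1 + d2.+1) :=
  block_mx (D1_irr d1) 0 0 (D1_irr d2).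
Definition D2_sum d1 d2 : 'M[K]_(d1.+1 + d2.+1) :=
  block_mx (D2_irr d1) 0 0 (D2_irr d2).

Definition joint_invariant d1 d2 (p : {mpoly K[d1.+1 + d2.+1]}) : Prop :=
  derivation_of (D1_sum d1 d2) p = 0 /\ derivation_of (D2_sum d1 d2) p = 0.

(* The homogeneous component of degree n of the algebra of joint invariants. *)
Definition joint_invariants d1 d2 n : {vspace dhomog (d1.+1 + d2.+1) K n} :=
  (lker (linfun (derivation_homog (D1_sum d1 d2) (n := n))) :&:
   lker (linfun (derivation_homog (D2_sum d1 d2) (n := n))))%VS.

Lemma mem_joint_invariants d1 d2 n (p : dhomog (d1.+1 + d2.+1) K n) :
  p \in joint_invariants d1 d2 n <-> joint_invariant (p : {mpoly K[_]}).
Proof.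
rewrite memv_cap !memv_ker !lfunE /=; split.
  by case/andP => /eqP/(congr1 val) h1 /eqP/(congr1 val) h2.
by case=> h1 h2; apply/andP; split; apply/eqP/val_inj.
Qed.

Definition poincare d1 d2 (n : nat) : K := (\dim (joint_invariants d1 d2 n))%:R.

End JointInvariants.

Section GeneratingFunction.
Variables d1 d2 : nat.

Definition f (L : fieldType) (t z : L) : L :=
  \prod_(j < d1.+1) (1 - t * z ^ (d1%:Z - (2 * j)%:Z))^-1 *
  \prod_(j < d2.+1) (1 - t * z ^ (d2%:Z - (2 * j)%:Z))^-1.

Definition F (L : fieldType) (t z : L) : L := f (t * z ^+ d2) z.

Lemma FE (L : fieldType) (t z : L) : z != 0 ->
  F t z = (\prod_(j < d1.+1) (1 - t * z ^ (d2%:Z - d1%:Z + (2 * j)%:Z)) *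
           \prod_(j < d2.+1) (1 - t * z ^ (2 * j)%:Z))^-1.
Proof.
move=> z0; rewrite /F /f invfM -!prodfV.
congr (_ * _); rewrite (reindex_inj rev_ord_inj) /=;
  apply: eq_bigr => i _; congr (_^-1); rewrite -mulrA exprnP -expfzDr //;
  congr (1 - t * z ^ _); have := ltn_ord i; lia.
Qed.

Variable K : fieldType.

Definition zvar : {fraction {poly K}} := ('X)%:F.
Definition tvar2 : ratfun2 K := ('X)%:F.
Definition zvar2 : ratfun2 K := (zvar%:P)%:F.

Definition A (k : nat) : {fraction {poly K}} :=
  - (zvar ^ (d2%:Z + d1%:Z - (2 * k)%:Z))^-1 *
  rateval
    (ratderiv (F tvar2 zvar2 *
               (1 - tvar2 * zvar2 ^ (d2%:Z + d1%:Z - (2 * k)%:Z)) ^+ 2))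
    (zvar ^ ((2 * k)%:Z - (d1%:Z + d2%:Z))).

Definition B (k : nat) : {fraction {poly K}} :=
  rateval
    (F tvar2 zvar2 * (1 - tvar2 * zvar2 ^ (d2%:Z + d1%:Z - (2 * k)%:Z)) ^+ 2)
    (zvar ^ ((2 * k)%:Z - (d1%:Z + d2%:Z))).

Definition C (k : nat) : {fraction {poly K}} :=
  rateval
    (F tvar2 zvar2 * (1 - tvar2 * zvar2 ^ (2 * k)%:Z))
    (zvar ^ (- (2 * k)%:Z)).

End GeneratingFunction.

(* Main.v *)
(* The commutator of D1 and D2 acts on monomials through their weights, and in
   degree n every nonzero weight space W_c has |c| bounded. A vector of W_0
   killed by D1 is also killed by D2, and D1 D2 is injective on W_2, so D1 maps
   W_0 onto W_2: the joint invariants of degree n have dimension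
   dim W_0 - dim W_2. Counting monomials identifies this number with the
   coefficient of t^n z^(n d2) in (1 - z^2) F(t, z).

   For the second identity, write d2 = d1 + 2a. As a function of t, F has its
   poles at t = z^(-2i), 0 <= i <= d2, double exactly for a <= i <= a + d1, and
   A_k, B_k (with k = d1 + a - i) and C_i are the coefficients of its partial
   fraction decomposition. The term of z^(2i) contributes to the coefficient of
   t^n z^(n d2) through the coefficient of z^(n (d2 - 2i)), which is what phi
   extracts. For 2i > d2 this vanishes: if n > 0 because the coefficients of the
   decomposition are regular at z = 0, and if n = 0 because they vanish there
   for i > 0. *)

Require Import Defs.
From HB Require Import structures.
From mathcomp Require Import all_boot all_order all_algebra.
From mathcomp Require Import reals complex.
From mathcomp Require Import ring zify.

Set Implicit Arguments.
Unset Strict Implicit.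
Unset Printing Implicit Defensive.

Import Order.TTheory GRing.Theory Num.Theory.

Local Open Scope ring_scope.

Local Notation "p %:F" := (FracField.tofrac p) : ring_scope.

(** * Representations of sl2 *)

Section SlTwo.
Variables (K : numFieldType) (V : vectType K) (e f h : 'End(V)).
Hypothesis commEF : forall v, e (f v) - f (e v) = h v.
Hypothesis commHE : forall v, h (e v) = e (h v) + 2%:R *: e v.
Hypothesis commHF : forall v, h (f v) = f (h v) - 2%:R *: f v.

Definition weight_space (c : K) : {vspace V} := lker (h - c *: \1%VF).

Lemma weight_spaceP c v : reflect (h v = c *: v) (v \in weight_space c).
Proof.
rewrite memv_ker add_lfunE opp_lfunE scale_lfunE id_lfunE subr_eq0.
exact: eqP.
Qed.

Lemma weight_iterE k c v :
  h v = c *: v -> h (iter k e v) = (c + (2 * k)%:R) *: iter k e v.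
Proof.
move=> hv; elim: k => [|k IHk] /=; first by rewrite muln0 addr0.
by rewrite commHE IHk linearZ -scalerDl -addrA -natrD -mulnSr.
Qed.

Lemma weight_iterF k c v :
  h v = c *: v -> h (iter k f v) = (c - (2 * k)%:R) *: iter k f v.
Proof.
move=> hv; elim: k => [|k IHk] /=; first by rewrite muln0 subr0.
by rewrite commHF IHk linearZ -scalerBl -addrA -opprD -natrD -mulnSr.
Qed.

(** The strings of [e] and [f] move weights by steps of 2. Raising weight 2 [M] times reaches
    2(M+1), lowering weight 0 [M.+1] times reaches -2(M+1), so one bound stops both strings. *)
Hypothesis weight_bound :
  exists M, weight_space (2 * M.+1)%:R = 0%VS /\
            weight_space (- (2 * M.+1)%:R) = 0%VS.

(** Here e f^(k+1) v = -(k+1)k f^k v, and the scalar is zero only for k = 0. Since some f^(M+1) v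
    vanishes by weight, the vanishing descends step by step to f v. *)
Lemma highest_weight0 v : h v = 0 -> e v = 0 -> f v = 0.
Proof.
move=> hv ev.
have efk k : e (iter k.+1 f v) = - (k.+1 * k)%:R *: iter k f v.
  elim: k => [|k IHk].
    rewrite muln0 oppr0 scale0r /= -[LHS](subrK (f (e v))) commEF hv ev.
    by rewrite linear0 addr0.
  rewrite [iter k.+2 f v]/= -[LHS](subrK (f (e (iter k.+1 f v)))) commEF IHk.
  rewrite (@weight_iterF k.+1 0) ?hv ?scale0r // linearZ -scalerDl.
  congr (_ *: _); rewrite sub0r -opprD -natrD; congr (- _%:R); lia.
have [M [_ WM]] := weight_bound.
have : iter M.+1 f v = 0.
  apply/eqP; rewrite -memv0 -WM; apply/weight_spaceP.
  by rewrite (@weight_iterF _ 0) ?sub0r // hv scale0r.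
elim: M {WM} => [//|k IHk] fk0; apply: IHk.
have /eqP := efk k.+1; rewrite fk0 linear0 eq_sym scaler_eq0 oppr_eq0.
by rewrite pnatr_eq0 muln_eq0 /= => /eqP.
Qed.

(** The same descent along the raising string: f e^(k+1) v = -(k+1)(k+2) e^k v, whose scalar never
    vanishes, so e^M v = 0 forces v = 0. *)
Lemma weight2_ef_inj v : h v = 2%:R *: v -> e (f v) = 0 -> v = 0.
Proof.
move=> hv efv.
(* The Casimir element acts on v as 0, hence on every e^k v. *)
have fek k : f (e (iter k e v)) = - (k.+1 * k.+2)%:R *: iter k e v.
  elim: k => [|k IHk].
    have := commEF v; rewrite efv sub0r hv => /(canRL (@opprK _)) ->.
    by rewrite scaleNr.
  have -> u : f (e u) = e (f u) - h u by rewrite -commEF opprB addrC subrK.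
  rewrite [in LHS](weight_iterE k.+1 hv) IHk linearZ -scalerBl.
  congr (_ *: _); rewrite -opprD -!natrD; congr (- _%:R); lia.
have [M [WM _]] := weight_bound.
have : iter M e v = 0.
  apply/eqP; rewrite -memv0 -WM; apply/weight_spaceP.
  by rewrite (weight_iterE _ hv) -natrD -mulnS.
elim: M {WM} => [//|k IHk] ek0; apply: IHk.
have /eqP := fek k; rewrite [e (iter k e v)]ek0 linear0 eq_sym scaler_eq0.
by rewrite oppr_eq0 pnatr_eq0 muln_eq0 /= => /eqP.
Qed.

Lemma dim_sl2_invariants :
  (\dim (lker e :&: lker f) + \dim (weight_space 2%:R) =
   \dim (weight_space 0))%N.
Proof.
have eW0 v : h v = 0 -> h (e v) = 2%:R *: e v.
  by move=> hv; rewrite commHE hv linear0 add0r.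
have fW2 v : h v = 2%:R *: v -> h (f v) = 0.
  by move=> hv; rewrite commHF hv linearZ subrr.
(* Invariants have weight 0 because h is the commutator of e and f; then rank-nullity for e on W_0
   leaves only the image e W_0 to be identified with W_2. *)
have -> : (lker e :&: lker f = weight_space 0 :&: lker e)%VS.
  apply/vspaceP => v; rewrite !memv_cap !(memv_ker e) !(memv_ker f) [LHS]andbC.
  apply/andP/andP => [[/eqP fv /eqP ev]|[/weight_spaceP]].
    split; last exact/eqP.
    by apply/weight_spaceP; rewrite -commEF fv ev scale0r !linear0 ?addr0.
  by rewrite scale0r => hv /eqP ev; rewrite ev (highest_weight0 hv ev).
rewrite -[RHS](limg_ker_dim e); congr (_ + \dim _)%N.
have ef_inj : (weight_space 2%:R :&: lker (e \o f) = 0)%VS.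
  apply/eqP; rewrite -subv0; apply/subvP => v.
  rewrite memv_cap memv_ker lfunE /= => /andP[/weight_spaceP hv /eqP efv].
  by rewrite (weight2_ef_inj hv efv) mem0v.
have le_e : (e @: weight_space 0 <= weight_space 2%:R)%VS.
  apply/subvP => _ /memv_imgP[v /weight_spaceP hv ->].
  by apply/weight_spaceP/eW0; rewrite hv scale0r.
(* Equality comes from dimensions: (e f) W_2, of dimension dim W_2 by injectivity, lies in e W_0,
   which lies in W_2. *)
have ge_e : ((e \o f) @: weight_space 2%:R <= e @: weight_space 0)%VS.
  apply/subvP => _ /memv_imgP[v /weight_spaceP hv ->]; rewrite lfunE /=.
  by apply/memv_img/weight_spaceP; rewrite scale0r fW2.
apply/esym/eqP; rewrite eqEdim le_e -(limg_dim_eq ef_inj).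
exact: dimvS.
Qed.
End SlTwo.

(** * The derivations D1 and D2 and their commutators *)

Section Derivations.
Variables (K : fieldType) (N : nat).
Implicit Types (M : 'M[K]_N) (p q : {mpoly K[N]}).

HB.instance Definition _ M :=
  GRing.isLinear.Build K {mpoly K[N]} {mpoly K[N]} _
    (derivation_of M) (derivation_of_linear M).

Lemma derivation_of1 M : derivation_of M 1 = 0.
Proof.
by rewrite /derivation_of big1 // => i _; rewrite -mpolyC1 mderivC mulr0.
Qed.

Lemma derivation_of_sum_X M (a : 'I_N -> K) :
  derivation_of M (\sum_j a j *: 'X_j) = \sum_k (\sum_j a j * M j k) *: 'X_k.
Proof.
rewrite linear_sum.
under eq_bigr => j _ do rewrite linearZ /= derivation_ofX scaler_sumr.
rewrite exchange_big; apply: eq_bigr => k _; rewrite scaler_suml.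
by apply: eq_bigr => j _; rewrite scalerA.
Qed.

Lemma derivation_ofZ c M p : derivation_of (c *: M) p = c *: derivation_of M p.
Proof.
rewrite /derivation_of scaler_sumr; apply: eq_bigr => i _.
rewrite scalerAl scaler_sumr; congr (_ * _); apply: eq_bigr => j _.
by rewrite mxE scalerA.
Qed.

(** Both sides are derivations, so agreement on the variables propagates to monomials and to all
    polynomials. The matrix products come in reversed order because rows hold the images of the
    variables. *)
Lemma commutator_derivation_of M M' p :
  derivation_of M (derivation_of M' p) - derivation_of M' (derivation_of M p)
  = derivation_of (M' *m M - M *m M') p.
Proof.
pose P p := derivation_of M (derivation_of M' p) -
  derivation_of M' (derivation_of M p) = derivation_of (M' *m M - M *m M') p.
have P1 : P 1 by rewrite /P !derivation_of1 !linear0 addr0.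
have PM q r : P q -> P r -> P (q * r).
  rewrite /P => Pq Pr; rewrite !derivation_ofM -Pq -Pr !raddfD /= !derivation_ofM.
  ring.
have PX i : P 'X_i.
  rewrite /P !derivation_ofX !derivation_of_sum_X -sumrB.
  by apply: eq_bigr => k _; rewrite -scalerBl !mxE.
have PD q r : P q -> P r -> P (q + r).
  by rewrite /P => Pq Pr; rewrite !raddfD /= -Pq -Pr; ring.
have PZ c q : P q -> P (c *: q).
  have DZ M1 r : derivation_of M1 (c *: r) = c *: derivation_of M1 r.
    exact: linearZ.
  by rewrite /P => Pq; rewrite !DZ -Pq scalerBr.
have P0 : P 0 by rewrite -(scale0r 1); apply: PZ.
rewrite [p]mpolyE; apply: (big_ind P) => // m _; apply: PZ; rewrite mpolyXE_id.
apply: (big_ind P) => // i _; elim: (m i) => [|k IHk]; first by rewrite expr0.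
by rewrite exprS; apply: PM.
Qed.

Lemma derivation_of_diag_X (a : 'rV[K]_N) m :
  derivation_of (diag_mx a) 'X_[m] = (\sum_i a 0 i *+ m i) *: 'X_[m].
Proof.
rewrite /derivation_of scaler_suml; apply: eq_bigr => i _.
rewrite (bigD1 i) //= big1 ?addr0 => [|j nji]; last first.
  by rewrite mxE eq_sym (negPf nji) mulr0n scale0r.
rewrite mxE eqxx mulr1n mderivX -scalerAl -scalerAr scalerA mulr_natr.
have [->|mi0] := eqVneq (m i) 0%N; first by rewrite !mulr0n !scale0r.
rewrite -mpolyXD addmC submK //; apply/mnm_lepP => j; rewrite mnm1E.
by case: eqVneq => // <-; rewrite lt0n.
Qed.

Lemma mcoeff_derivation_of_diag (a : 'rV[K]_N) p m :
  (derivation_of (diag_mx a) p)@_m = (\sum_i a 0 i *+ m i) * p@_m.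
Proof.
rewrite {1 2}[p]mpolyE (linear_sum (derivation_of (diag_mx a))).
rewrite !(raddf_sum (mcoeff m)) mulr_sumr /=.
apply: eq_bigr => m' _ /=.
rewrite linearZ /= derivation_of_diag_X !mcoeffZ mcoeffX.
by case: eqVneq => [->|_]; rewrite ?mulr0 // !mulr1 mulrC.
Qed.

End Derivations.

(** The diagonal entry is (d - i)(i + 1) - i(d - i + 1) = d - 2i, the weight of v_i. *)
Lemma commutator_D1_D2_irr (K : fieldType) d :
  D2_irr K d *m D1_irr K d - D1_irr K d *m D2_irr K d
  = diag_mx (\row_(i < d.+1) (d%:R - (2 * i)%:R)).
Proof.
apply/matrixP => i j; rewrite !mxE.
have dm1 (k : nat) : (k < d)%N -> (k.+1 < d.+1)%N by [].
have -> : \sum_k D2_irr K d i k * D1_irr K d k j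
    = ((d - i) * i.+1)%:R *+ (i == j).
  have [lt_id|ge_di] := ltnP i d; last first.
    rewrite big1 => [|k _]; last first.
      rewrite !mxE; case: eqP => ki; rewrite ?mul0r //.
      by have := ltn_ord k; lia.
    have -> : (d - i = 0)%N by lia.
    by rewrite mul0n mul0rn.
  rewrite (bigD1 (Ordinal (dm1 i lt_id))) //= big1 => [|k]; last first.
    by rewrite !mxE -val_eqE /= => /negPf ->; rewrite mul0r.
  rewrite !mxE /= !eqxx eqSS val_eqE addr0.
  by case: eqP; rewrite ?mulr0 ?mulr0n // natrM.
(* The factor [i] absorbs the truncated predecessor at [i = 0]. *)
have -> : \sum_k D1_irr K d i k * D2_irr K d k j
    = (i * (d - i.-1))%:R *+ (i == j).
  have [i0|i_gt0] := posnP i.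
    rewrite i0 mul0n mul0rn big1 // => k _.
    by rewrite !mxE i0 mul0r.
  have lt_id : (i.-1 < d.+1)%N by have := ltn_ord i; lia.
  rewrite (bigD1 (Ordinal lt_id)) //= big1 => [|k nk]; last first.
    rewrite !mxE; case: eqP => ik; rewrite ?mul0r //.
    by case/eqP: nk; apply: val_inj => /=; rewrite ik.
  rewrite !mxE /= prednK // eqxx addr0 val_eqE eq_sym.
  by case: eqP; rewrite ?mulr0 ?mulr0n // natrM.
rewrite -mulrnBl; congr (_ *+ _); apply/eqP.
rewrite subr_eq addrAC eq_sym subr_eq -!natrD; apply/eqP; congr _%:R.
by have := ltn_ord i; case: i => -[|i] /= _; nia.
Qed.

Definition weight_row (K : fieldType) d1 d2 : 'rV[K]_(d1.+1 + d2.+1) :=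
  row_mx (\row_(i < d1.+1) (d1%:R - (2 * i)%:R))
         (\row_(i < d2.+1) (d2%:R - (2 * i)%:R)).

Lemma commutator_D1_D2_sum (K : fieldType) d1 d2 :
  D2_sum K d1 d2 *m D1_sum K d1 d2 - D1_sum K d1 d2 *m D2_sum K d1 d2
  = diag_mx (weight_row K d1 d2).
Proof.
rewrite /D1_sum /D2_sum !mulmx_block !mulmx0 !mul0mx !addr0 !add0r.
rewrite opp_block_mx add_block_mx !oppr0 !addr0 !commutator_D1_D2_irr.
by rewrite diag_mx_row.
Qed.

Lemma commutator_D1_weight (K : fieldType) d1 d2 :
  D1_sum K d1 d2 *m diag_mx (weight_row K d1 d2) -
    diag_mx (weight_row K d1 d2) *m D1_sum K d1 d2 = 2%:R *: D1_sum K d1 d2.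
Proof.
have irr d : D1_irr K d *m diag_mx (\row_(i < d.+1) (d%:R - (2 * i)%:R)) -
    diag_mx (\row_(i < d.+1) (d%:R - (2 * i)%:R)) *m D1_irr K d
    = 2%:R *: D1_irr K d.
  apply/matrixP => i j; rewrite mul_mx_diag mul_diag_mx !mxE.
  case: eqP => [->|_]; last by rewrite !mulr0 mul0r subrr.
  rewrite mulnS natrD; ring.
rewrite /weight_row diag_mx_row /D1_sum !mulmx_block !mulmx0 !mul0mx.
rewrite !addr0 !add0r opp_block_mx add_block_mx scale_block_mx.
by rewrite !oppr0 !addr0 !irr !scaler0.
Qed.

Lemma commutator_D2_weight (K : fieldType) d1 d2 :
  D2_sum K d1 d2 *m diag_mx (weight_row K d1 d2) -
    diag_mx (weight_row K d1 d2) *m D2_sum K d1 d2 = - 2%:R *: D2_sum K d1 d2.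
Proof.
have irr d : D2_irr K d *m diag_mx (\row_(i < d.+1) (d%:R - (2 * i)%:R)) -
    diag_mx (\row_(i < d.+1) (d%:R - (2 * i)%:R)) *m D2_irr K d
    = - 2%:R *: D2_irr K d.
  apply/matrixP => i j; rewrite mul_mx_diag mul_diag_mx !mxE.
  case: eqP => [->|_]; last by rewrite !mulr0 mul0r subrr.
  rewrite mulnS natrD; ring.
rewrite /weight_row diag_mx_row /D2_sum !mulmx_block !mulmx0 !mul0mx.
rewrite !addr0 !add0r opp_block_mx add_block_mx scale_block_mx.
by rewrite !oppr0 !addr0 !irr !scaler0.
Qed.

(** * Weight spaces *)

(** In degree [n] no exponent exceeds [n]; encoding monomials by bounded functions makes them a
    finite type on which cardinals can be taken. *)
Definition exponents N n (f : {ffun 'I_N -> 'I_n.+1}) : 'X_{1..N} :=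
  [multinom (f i : nat) | i < N].

Lemma exponents_inj N n : injective (@exponents N n).
Proof.
move=> f g efg; apply/ffunP => i; apply: val_inj.
by have := congr1 (fun m : 'X_{1..N} => m i) efg; rewrite /= !mnmE.
Qed.

Lemma exponents_surj N n (m : 'X_{1..N}) :
  mdeg m = n -> exists f : {ffun 'I_N -> 'I_n.+1}, exponents f = m.
Proof.
move=> dm; exists [ffun i => inord (m i)]; apply/mnmP => i.
rewrite mnmE ffunE inordK // ltnS -dm mdegE (bigD1 i) //=; exact: leq_addr.
Qed.

Section WeightSpaces.
Variables (K : numFieldType) (N n : nat) (a : 'rV[K]_N.+1).

Definition weight_op : 'End(dhomog N.+1 K n) :=
  linfun (derivation_homog (diag_mx a) (n := n)).

Definition weight_exponents (c : K) : {set {ffun 'I_N.+1 -> 'I_n.+1}} :=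
  [set f : {ffun 'I_N.+1 -> 'I_n.+1} | (\sum_i f i == n)%N &&
    (\sum_i a 0 i *+ f i == c)].

(** Monomials are eigenvectors of a diagonal derivation, so those of weight [c] form a basis of the
    weight space. *)
Lemma dim_weight_space c :
  \dim (weight_space weight_op c) = #|weight_exponents c|.
Proof.
set T := weight_exponents c.
have coefZ k (p : dhomog N.+1 K n) m :
    (k *: p : dhomog _ _ _)@_m = k * (p : {mpoly K[_]})@_m by exact: mcoeffZ.
(* [indhomog] is faithful only on polynomials of degree [n]; membership in [T] guarantees this,
   hence [val_mon]. *)
pose mon (f : {ffun 'I_N.+1 -> 'I_n.+1}) : dhomog N.+1 K n :=
    indhomog n 'X_[exponents f].
have val_mon f : f \in T -> mon f = 'X_[exponents f] :> {mpoly K[N.+1]}.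
  rewrite inE => /andP[/eqP df _]; apply: insubdK.
  rewrite unfold_in dhomogX /= mdegE -[X in _ == X]df.
  by apply/eqP/eq_bigr => i _; rewrite mnmE.
pose X := [tuple mon (enum_val i) | i < #|T|].
have freeX : free X.
  apply/freeP => k k0 j.
  have {}k0 : \sum_i k i *: mon (enum_val i) = 0.
    by rewrite -[RHS]k0; apply: eq_bigr => i _; rewrite -tnth_nth tnth_mktuple.
  have := congr1 (fun p : dhomog _ K n =>
    (p : {mpoly K[_]})@_(exponents (enum_val j))) k0.
  rewrite /= mcoeff0 raddf_sum raddf_sum /= (bigD1 j) //= big1 => [|i nij].
    by rewrite coefZ val_mon ?enum_valP // mcoeffX eqxx mulr1 addr0.
  rewrite coefZ val_mon ?enum_valP // mcoeffX.
  by rewrite (inj_eq (@exponents_inj _ _)) (inj_eq enum_val_inj) (negPf nij) mulr0.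
suff -> : weight_space weight_op c = <<X>>%VS.
  by rewrite (eqP freeX) size_tuple.
have weight_opE (v : dhomog N.+1 K n) m :
    (weight_op v : {mpoly K[_]})@_m = (\sum_i a 0 i *+ m i) * (v : {mpoly K[_]})@_m.
  by rewrite lfunE /= mcoeff_derivation_of_diag.
apply/eqP; rewrite eqEsubv; apply/andP; split.
  apply/subvP => v /weight_spaceP hv.
  have -> : v = \sum_(f in T) (v : {mpoly K[_]})@_(exponents f) *: mon f.
    apply/val_inj/mpolyP => m /=; rewrite raddf_sum raddf_sum /=.
    under eq_bigr => f fT do rewrite coefZ val_mon // mcoeffX.
    have [v0|vm] := eqVneq ((v : {mpoly K[_]})@_m) 0.
      rewrite v0 big1 // => f fT.
      by case: eqP => [->|_]; rewrite ?v0 ?mul0r ?mulr0.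
    have dm : mdeg m = n.
      apply/eqP; apply: contraNT vm => dm.
      by rewrite (dhomog_nemf_coeff (dhomog_is_dhomog v) dm).
    have [f fm] := exponents_surj dm.
    have fT : f \in T.
      rewrite inE; apply/andP; split.
        rewrite -[X in _ == X]dm -fm mdegE.
        by apply/eqP/eq_bigr => i _; rewrite mnmE.
      have := congr1 (fun p : dhomog _ K n => (p : {mpoly K[_]})@_m) hv.
      rewrite weight_opE coefZ => /(mulIf vm) <-.
      by apply/eqP/eq_bigr => i _; rewrite -fm mnmE.
    rewrite (bigD1 f) //= fm eqxx mulr1 big1 ?addr0 // => g /andP[_ ngf].
    by rewrite -fm (inj_eq (@exponents_inj _ _)) (negPf ngf) mulr0.
  apply: memv_suml => f fT; apply/memvZ/memv_span.
  by rewrite -[f](enum_rankK_in fT fT); apply: map_f; rewrite mem_enum.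
apply/span_subvP => _ /mapP[i _ ->]; apply/weight_spaceP/val_inj/mpolyP => m.
have iT := enum_valP i.
rewrite weight_opE coefZ val_mon // mcoeffX.
case: eqP => [<-|_]; last by rewrite !mulr0.
congr (_ * _); move: iT; rewrite inE => /andP[_ /eqP <-].
by apply: eq_bigr => j _; rewrite mnmE.
Qed.

End WeightSpaces.

(** A monomial of degree [n] is a product of [n] variables of weight at most [b] in absolute
    value. *)
Lemma weight_space_eq0 (K : numFieldType) N n (a : 'rV[K]_N.+1) (b : nat) c :
  (forall i, `|a 0 i| <= b%:R) -> (b * n)%:R < `|c| ->
  weight_space (weight_op n a) c = 0%VS.
Proof.
move=> le_ab lt_c; apply/eqP; rewrite -dimv_eq0 dim_weight_space cards_eq0.
apply/eqP/setP => f; rewrite inE [RHS]inE; apply/negP => /andP[/eqP fn /eqP fc].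
have := lt_le_trans lt_c; rewrite -fc => /(_ _ (ler_norm_sum _ _ _)) lt_s.
suff /(lt_le_trans lt_s) : \sum_i `|a 0 i *+ f i| <= (b * n)%:R by rewrite ltxx.
rewrite -[in leRHS]fn big_distrr natr_sum /=; apply: ler_sum => i _.
by rewrite normrMn natrM mulr_natr lerMn2r le_ab orbT.
Qed.

Lemma weight_exponentsE (K : numFieldType) N n (a : 'rV[K]_N.+1) (d w : nat)
    (e : 'I_N.+1 -> nat) :
  (forall i, a 0 i = d%:R - (e i)%:R) ->
  weight_exponents n a w%:R =
  [set f : {ffun 'I_N.+1 -> 'I_n.+1} |
    (\sum_i f i == n)%N && (\sum_i e i * f i + w == n * d)%N].
Proof.
move=> aE; apply/setP => f; rewrite !inE; case: eqP => //= fn.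
have -> : \sum_i a 0 i *+ f i = (n * d)%:R - (\sum_i e i * f i)%:R.
  rewrite -[in (n * d)%N]fn big_distrl !natr_sum -sumrB; apply: eq_bigr => i _.
  by rewrite aE mulrnBl -!mulrnA mulnC.
by rewrite subr_eq -natrD eqr_nat addnC eq_sym.
Qed.

(** * Dimension of the joint invariants as a difference of monomial counts *)

Section JointInvariantDimension.
Variables (K : numFieldType) (d1 d2 n : nat).

(* d2 minus the weight of the variable, so that a monomial of degree n has
   weight w exactly when its exponents add up to n * d2 - w. *)
Definition var_exponent (i : 'I_(d1.+1 + d2.+1)) : nat :=
  match split i with
  | inl j => d2 - d1 + 2 * j
  | inr j => 2 * j
  end.

Definition exponent_count (w : nat) : nat :=
  #|[set f : {ffun 'I_(d1.+1 + d2.+1) -> 'I_n.+1} |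
     (\sum_i f i == n)%N && (\sum_i var_exponent i * f i + w == n * d2)%N]|.

Lemma weight_row_exponent i : (d1 <= d2)%N ->
  weight_row K d1 d2 0 i = d2%:R - (var_exponent i)%:R.
Proof.
move=> le_d; rewrite /var_exponent mxE; case: split => j; rewrite mxE //.
by rewrite natrD natrB //; ring.
Qed.

(** In degree [n], the derivations D1, D2 and the diagonal one of [weight_row] form the sl2-triple
    (e, f, h). *)
Lemma dim_joint_invariants : (d1 <= d2)%N ->
  (\dim (joint_invariants K d1 d2 n) + exponent_count 2 = exponent_count 0)%N.
Proof.
move=> le_d; rewrite /exponent_count.
rewrite -!(weight_exponentsE _ _ (fun i => weight_row_exponent i le_d)).
rewrite -!dim_weight_space; apply: dim_sl2_invariants => [v|v|v|].
- rewrite !lfunE; apply/val_inj; rewrite /= commutator_derivation_of.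
  by rewrite commutator_D1_D2_sum.
- have := commutator_derivation_of (diag_mx (weight_row K d1 d2))
    (D1_sum K d1 d2) v.
  rewrite commutator_D1_weight derivation_ofZ => /(canRL (subrK _)) E.
  by rewrite [RHS]addrC !lfunE; apply/val_inj; exact: E.
- have := commutator_derivation_of (diag_mx (weight_row K d1 d2))
    (D2_sum K d1 d2) v.
  rewrite commutator_D2_weight derivation_ofZ scaleNr => /(canRL (subrK _)) E.
  by rewrite [RHS]addrC !lfunE; apply/val_inj; exact: E.
have bound i : `|weight_row K d1 d2 0 i| <= (3 * (d1 + d2))%:R.
  rewrite weight_row_exponent //; apply: le_trans (ler_normB _ _) _.
  rewrite !normr_nat -natrD ler_nat /var_exponent.
  by case: split => j; have := ltn_ord j; lia.
(* All weights in degree [n] are at most 3(d1 + d2)n in absolute value, so this [M] satisfies the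
   strict inequality with 2(M+1). *)
exists (3 * (d1 + d2) * n)%N.
by split; apply: (weight_space_eq0 bound); rewrite ?normrN normr_nat ltr_nat; lia.
Qed.
End JointInvariantDimension.

(** * Power series expansion of rational functions *)

Lemma dvdp_sum (K : fieldType) (I : finType) (P : pred I) (d : {poly K})
    (p : I -> {poly K}) :
  (forall i, P i -> d %| p i) -> d %| \sum_(i | P i) p i.
Proof.
move=> dv; apply: (big_ind (fun q => d %| q)) => //.
by move=> q r dq dr; rewrite dvdp_add.
Qed.

Section Expansions.
Variable K : fieldType.
Implicit Types (p q u v : {poly K}) (s : nat -> K) (r : {fraction {poly K}}).

(** This is the power series identity p = q s, stated modulo each power of ['X] so that only
    polynomial divisibility is involved. *)
Definition expands p q s := forall n, 'X^n %| p - q * \poly_(i < n) s i.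

Lemma dvdXn_coef0 n p i : 'X^n %| p -> (i < n)%N -> p`_i = 0.
Proof. by case/dvdpP => c -> lt_in; rewrite coefMXn lt_in. Qed.

Lemma dvdXn_coefP n p : (forall i, (i < n)%N -> p`_i = 0) -> 'X^n %| p.
Proof.
move=> p0; rewrite -[p](poly_take_drop n) dvdp_addl ?dvdp_mulIr //.
suff -> : take_poly n p = 0 by exact: dvdp0.
by apply/polyP => i; rewrite coef_take_poly coef0; case: ifP => // /p0.
Qed.

Lemma dvdXn_mull n p q : q`_0 != 0 -> 'X^n %| q * p -> 'X^n %| p.
Proof.
move=> q0; rewrite Gauss_dvdpr //; apply: coprimep_expl.
by rewrite -['X]subr0 -polyC0 coprimep_sym coprimep_XsubC rootE horner_coef0.
Qed.

(** A denominator with nonzero constant term is invertible modulo ['X^n], so the first [n]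
    coefficients of the quotient are determined. *)
Lemma expands_coef p q s u n i :
  q`_0 != 0 -> expands p q s -> 'X^n %| p - q * u -> (i < n)%N -> s i = u`_i.
Proof.
move=> q0 /(_ n) e1 e2 lt_in.
have : 'X^n %| q * (u - \poly_(i < n) s i).
  rewrite [X in _ %| X](_ : _ = (p - q * \poly_(i < n) s i) - (p - q * u)).
    by rewrite dvdp_sub.
  by ring.
move/(dvdXn_mull q0)/(dvdXn_coef0)/(_ lt_in)/eqP.
by rewrite coefB coef_poly lt_in subr_eq0 => /eqP.
Qed.

Lemma expands_poly p : expands p 1 (fun i => p`_i).
Proof.
move=> n; apply: dvdXn_coefP => i lt_in.
by rewrite coefB mul1r coef_poly lt_in subrr.
Qed.

Lemma expandsD p q u v s s' : expands p q s -> expands u v s' ->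
  expands (p * v + u * q) (q * v) (fun i => s i + s' i).
Proof.
move=> e e' n.
have -> : \poly_(i < n) (s i + s' i) = \poly_(i < n) s i + \poly_(i < n) s' i.
  by apply/polyP => i; rewrite coefD !coef_poly; case: ifP; rewrite ?addr0.
rewrite [X in _ %| X](_ : _ = v * (p - q * \poly_(i < n) s i) +
  q * (u - v * \poly_(i < n) s' i)); last by ring.
by rewrite dvdp_add // dvdp_mull.
Qed.

Lemma expandsM u p q s : expands p q s ->
  expands (u * p) q (fun n => \sum_(i < n.+1) u`_i * s (n - i)%N).
Proof.
move=> e n; set S := \poly_(i < n) _.
have e2 : 'X^n %| u * \poly_(i < n) s i - S.
  apply: dvdXn_coefP => i lt_in; rewrite coefB coefM coef_poly lt_in.
  apply/eqP; rewrite subr_eq0; apply/eqP/eq_bigr => j _; rewrite coef_poly.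
  by rewrite (leq_ltn_trans (leq_subr _ _) lt_in).
rewrite [X in _ %| X](_ : _ = u * (p - q * \poly_(i < n) s i) +
  q * (u * \poly_(i < n) s i - S)); last by ring.
by rewrite dvdp_add // dvdp_mull.
Qed.

Lemma ratden_coef0 p q : q`_0 != 0 -> (ratden (p%:F / q%:F))`_0 != 0.
Proof.
move=> q0; have nz : q != 0 by apply: contraNneq q0 => ->; rewrite coef0.
apply: contraNneq q0 => d0; have /dvdpP[c ->] := ratden_dvdp p nz.
by rewrite coefM big_ord1 d0 mulr0.
Qed.

Lemma ratnumM p q : q != 0 ->
  ratnum (p%:F / q%:F) * q = p * ratden (p%:F / q%:F).
Proof.
move=> q0; have /eqP := ratnum_div_ratden (p%:F / q%:F).
by rewrite eqr_div ?tofrac_eq0 ?ratden_neq0 // -!tofracM tofrac_eq => /eqP->.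
Qed.

(** [ratseries] is computed from the reduced fraction. After multiplication by its denominator,
    which is prime to ['X], the claim becomes [q] times the recurrence [ratseriesP]. *)
Lemma expands_div p q : q`_0 != 0 -> expands p q (ratseries (p%:F / q%:F)).
Proof.
move=> q0 n; have d0 := ratden_coef0 p q0.
have /(ratnumM p) : q != 0 by apply: contraNneq q0 => ->; rewrite coef0.
set r := _ / _ in d0 *; set S := \poly_(_ < _) _ => rd.
apply: (dvdXn_mull d0).
rewrite [X in _ %| X](_ : _ = q * (ratnum r - ratden r * S)); last first.
  by rewrite mulrBr [ratden r * p]mulrC -rd; ring.
apply/dvdp_mull/dvdXn_coefP => j lt_jn.
rewrite coefB mulrC coefM -(ratseriesP d0) -sumrB big1 // => k _.
rewrite coef_poly (leq_ltn_trans _ lt_jn) ?subrr //.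
by rewrite -ltnS.
Qed.

Lemma expands_ratseries p q s :
  q`_0 != 0 -> expands p q s -> ratseries (p%:F / q%:F) =1 s.
Proof.
move=> q0 e i; rewrite (expands_coef q0 (expands_div p q0) (e _) (leqnn i.+1)).
by rewrite coef_poly leqnn.
Qed.

(** The local ring of K[z] at 0, on which [ratseries] is additive and compatible with products by
    polynomials. *)
Definition regular r := exists p q, q`_0 != 0 /\ r = p%:F / q%:F.

Lemma regularP r : regular r ->
  exists p q, [/\ q`_0 != 0, r = p%:F / q%:F & expands p q (ratseries r)].
Proof.
by case=> p [q [q0 ->]]; exists p, q; split=> //; apply: expands_div.
Qed.

Lemma coef0_neq0 q : q`_0 != 0 -> q%:F != 0.
Proof. by rewrite tofrac_eq0; apply: contraNneq => ->; rewrite coef0. Qed.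

Lemma regular_poly p : regular p%:F.
Proof. by exists p, 1; rewrite coef1 oner_neq0 tofrac1 divr1. Qed.

Lemma regularD r r' : regular r -> regular r' -> regular (r + r').
Proof.
move=> [p [q [q0 ->]]] [u [v [v0 ->]]]; exists (p * v + u * q), (q * v).
rewrite coefM big_ord1 mulf_neq0 //; split=> //.
by rewrite addf_div ?coef0_neq0 // !(tofracD, tofracM).
Qed.

Lemma regularM r r' : regular r -> regular r' -> regular (r * r').
Proof.
move=> [p [q [q0 ->]]] [u [v [v0 ->]]]; exists (p * u), (q * v).
rewrite coefM big_ord1 mulf_neq0 //; split=> //.
by rewrite mulf_div !tofracM.
Qed.

Lemma regularN r : regular r -> regular (- r).
Proof.
move=> [p [q [q0 ->]]]; exists (- p), q; split=> //.
by rewrite tofracN mulNr.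
Qed.

Lemma ratseriesD r r' n : regular r -> regular r' ->
  ratseries (r + r') n = ratseries r n + ratseries r' n.
Proof.
move=> /regularP[p [q [q0 rE e]]] /regularP[u [v [v0 rE' e']]].
rewrite {1}rE {1}rE' addf_div ?coef0_neq0 // -!tofracM -tofracD.
apply: (expands_ratseries _ (expandsD e e')).
by rewrite coefM big_ord1 mulf_neq0.
Qed.

Lemma ratseries_poly p n : ratseries p%:F n = p`_n.
Proof.
rewrite -[p%:F]divr1 -tofrac1.
by apply: expands_ratseries (expands_poly p) _; rewrite coef1 oner_neq0.
Qed.

Lemma ratseries_sum (I : finType) (P : pred I) (r : I -> {fraction {poly K}}) n :
  (forall i, P i -> regular (r i)) ->
  ratseries (\sum_(i | P i) r i) n = \sum_(i | P i) ratseries (r i) n.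
Proof.
move=> rr.
(* Regularity is carried through the induction because [ratseriesD] asks it of the partial sums. *)
pose R0 x y := regular x /\ ratseries x n = y.
suff [_ ->] : R0 (\sum_(i | P i) r i) (\sum_(i | P i) ratseries (r i) n) by [].
apply: (big_ind2 R0) => [|x y x' y' [rx <-] [rx' <-]|i /rr ri]; split=> //.
- by rewrite -tofrac0; apply: regular_poly.
- by rewrite -tofrac0 ratseries_poly coef0.
- exact: regularD.
exact: ratseriesD.
Qed.

Lemma ratseries_polyM u r n : regular r ->
  ratseries (u%:F * r) n = \sum_(i < n.+1) u`_i * ratseries r (n - i).
Proof.
move=> /regularP[p [q [q0 rE e]]]; rewrite {1}rE mulrA -tofracM.
exact: (expands_ratseries q0 (expandsM u e)).
Qed.

Lemma ratseries_constM c r n : regular r ->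
  ratseries (c%:P%:F * r) n = c * ratseries r n.
Proof.
move=> rr; rewrite ratseries_polyM // big_ord_recl subn0 coefC eqxx.
by rewrite big1 ?addr0 // => i _; rewrite coefC mul0r.
Qed.

Lemma ratseries_XnM m r n : regular r ->
  ratseries (('X^m)%:F * r) n = if (m <= n)%N then ratseries r (n - m) else 0.
Proof.
move=> rr; rewrite ratseries_polyM //; case: leqP => [le_mn|lt_nm].
  rewrite (bigD1 (inord m)) //= inordK ?ltnS // coefXn eqxx mul1r.
  rewrite big1 ?addr0 // => i; rewrite -val_eqE /= inordK ?ltnS // coefXn.
  by move/negPf=> ->; rewrite mul0r.
rewrite big1 // => i _; rewrite coefXn; case: eqP => [im|_]; last exact: mul0r.
by have := ltn_ord i; lia.
Qed.

Lemma poly_recr (E : nat -> K) n :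
  \poly_(i < n.+1) E i = \poly_(i < n) E i + E n *: 'X^n.
Proof. by rewrite !poly_def big_ord_recr. Qed.

(** The factor 1 - t x with ['X] as t: it vanishes at [x^-1] when [x] is nonzero, and its constant
    term 1 makes it invertible as a power series. *)
Definition pole x : {poly K} := 1 - 'X * x%:P.

Lemma pole_coef0 x : (pole x)`_0 = 1.
Proof. by rewrite coefB coef1 coefXM subr0. Qed.

Lemma expands_pole a x : expands a%:P (pole x) (fun i => a * x ^+ i).
Proof.
move=> n; have -> : a%:P - pole x * \poly_(i < n) (a * x ^+ i)
    = (a * x ^+ n)%:P * 'X^n; last by rewrite dvdp_mulIr.
elim: n => [|n IHn]; first by rewrite poly_def big_ord0 mulr0 subr0 !mulr1.
rewrite poly_recr mulrDr opprD addrA IHn.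
rewrite -mul_polyC !polyCM !polyC_exp /pole exprS [in RHS]exprS.
move: (x%:P) (a%:P) 'X => y c X; ring.
Qed.

(** The factor [i.+1] comes from 1/(1 - t x)^2; it is what later becomes the derivative of z times a
    series. *)
Lemma expands_double_pole a b x :
  expands (a%:P * pole x + b%:P) (pole x ^+ 2)
    (fun i => (a + i.+1%:R * b) * x ^+ i).
Proof.
have e := expands_pole a x.
suff e' : expands b%:P (pole x ^+ 2) (fun i => i.+1%:R * b * x ^+ i).
  move=> n; have := e n; have := e' n.
  have -> : \poly_(i < n) ((a + i.+1%:R * b) * x ^+ i) =
    \poly_(i < n) (a * x ^+ i) + \poly_(i < n) (i.+1%:R * b * x ^+ i).
    by apply/polyP => i; rewrite coefD !coef_poly; case: ifP; rewrite ?addr0 ?mulrDl.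
  move=> e1 e2; set S := \poly_(_ < _) _ in e2 *.
  set T := \poly_(_ < _) _ in e1 *.
  rewrite [X in _ %| X](_ : _ = pole x * (a%:P - pole x * S) +
    (b%:P - pole x ^+ 2 * T)); last by ring.
  by rewrite dvdp_add // dvdp_mull.
(* With the remainder in closed form, the induction on [n] reduces to ring identities. *)
move=> n; have -> : b%:P - pole x ^+ 2 * \poly_(i < n) (i.+1%:R * b * x ^+ i)
    = b%:P * ((n.+1%:R * x ^+ n)%:P - n%:R%:P * (x ^+ n.+1)%:P * 'X) * 'X^n;
  last by rewrite dvdp_mulIr.
elim: n => [|n IHn].
  by rewrite poly_def big_ord0 mulr0 subr0 polyC0 !mul0r subr0 !mulr1.
rewrite poly_recr mulrDr opprD addrA IHn.
rewrite -mul_polyC !polyCM !polyC_exp !polyC_natr /pole !exprS.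
move: (x%:P) (b%:P) 'X => y c X; ring.
Qed.

Lemma pole_neq0 x : pole x != 0.
Proof.
by apply: contra_eq_neq (pole_coef0 x) => ->; rewrite coef0 eq_sym oner_neq0.
Qed.

Lemma horner_pole x y : (pole x).[y] = 1 - y * x.
Proof. by rewrite !hornerE. Qed.

Lemma pole_XsubC x : x != 0 -> pole x = - x *: ('X - (x^-1)%:P).
Proof.
move=> x0; rewrite /pole scaleNr scalerBr opprB scale_polyC divff //.
by rewrite -mul_polyC mulrC.
Qed.

End Expansions.

(** * Partial fractions *)

Section PartialFractions.
Variables (K : fieldType) (I : finType).

Lemma prod_dvdp (u : I -> {poly K}) (d : {poly K}) :
  (forall i j, i != j -> coprimep (u i) (u j)) ->
  (forall i, u i %| d) -> \prod_i u i %| d.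
Proof.
move=> cop dv; have := index_enum_uniq I.
elim: (index_enum I) => [|i r IHr] /=; first by rewrite big_nil dvd1p.
case/andP => ir ur; rewrite big_cons Gauss_dvdp ?dv ?IHr //.
rewrite big_seq; apply: (big_ind (fun p => coprimep (u i) p)).
- exact: coprimep1.
- by move=> p q; rewrite coprimepMr => -> ->.
by move=> j jr; apply: cop; apply: contraNneq ir => ->.
Qed.

(** Modulo [u i] every summand but the i-th vanishes, so 1 minus the sum is divisible by all the
    coprime [u i], hence by their product. Its degree is smaller, so it is zero; [i0] makes the
    product nonconstant, which bounds the term 1. *)
Lemma partial_fractions (u p : I -> {poly K}) (i0 : I) :
  (forall i j, i != j -> coprimep (u i) (u j)) ->
  (1 < size (u i0))%N ->
  (forall i, (size (p i) < size (u i))%N) ->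
  (forall i, u i %| 1 - p i * \prod_(j | j != i) u j) ->
  \sum_i p i * \prod_(j | j != i) u j = 1.
Proof.
move=> cop u0 lt_p dv; apply/eqP; rewrite eq_sym -subr_eq0.
have nzu i : u i != 0 by rewrite -size_poly_gt0 (leq_ltn_trans _ (lt_p i)).
have nzq i : \prod_(j | j != i) u j != 0 by apply/prodf_neq0.
have prodE i : \prod_j u j = u i * \prod_(j | j != i) u j by rewrite (bigD1 i).
set D := 1 - _; have uD : \prod_i u i %| D.
  apply: prod_dvdp => // i; rewrite /D (bigD1 i) //= opprD addrA.
  apply: dvdp_sub => //; apply: dvdp_sum => k nki.
  by rewrite dvdp_mull // (bigD1 i) 1?eq_sym //= dvdp_mulr.
apply: contraLR uD => nzD; apply: contraL (nzD) => /(dvdp_leq nzD).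
rewrite leqNgt; apply: contraNN => _; apply: leq_ltn_trans (size_polyD _ _) _.
have szP i : (size (p i * \prod_(j | j != i) u j)%R < size (\prod_j u j)%R)%N.
  rewrite (prodE i); apply: leq_ltn_trans (size_polyMleq _ _) _.
  rewrite size_mul //; move: (nzq i) (lt_p i); rewrite -size_poly_gt0.
  by move: (size _) (size (u i)) (size (p i)) => a b c; lia.
rewrite gtn_max size_poly1 size_polyN; apply/andP; split.
  rewrite (prodE i0) size_mul //; move: (nzq i0) u0; rewrite -size_poly_gt0.
  by move: (size _) (size (u i0)) => a b; lia.
apply: leq_ltn_trans (size_sum _ _ _) _.
have : (0 < size (\prod_j u j)%R)%N by rewrite (leq_ltn_trans _ (szP i0)).
case: (size (\prod_j u j)%R) szP => // m szP _; rewrite ltnS.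
by apply/bigmax_leqP => i _; rewrite -ltnS.
Qed.

End PartialFractions.

(** * Principal parts at simple and double poles *)

Section Poles.
Variable K : fieldType.
Implicit Types (x a : K) (p q : {poly K}).

Lemma dvd_pole x p : x != 0 -> (pole x %| p) = root p x^-1.
Proof. by move=> x0; rewrite pole_XsubC // dvdpZl ?oppr_eq0 // dvdp_XsubCl. Qed.

Lemma dvd_pole2 x p : x != 0 -> root p x^-1 -> root p^`() x^-1 ->
  pole x ^+ 2 %| p.
Proof.
move=> x0; rewrite -(dvd_pole _ x0) => /dvdpP[c ->].
rewrite derivM rootE hornerD !hornerM (horner_pole x) mulVf // subrr mulr0 add0r.
rewrite pole_XsubC // derivZ derivB derivX derivC subr0 hornerZ hornerC mulr1.
rewrite -pole_XsubC // mulf_eq0 oppr_eq0 (negPf x0) orbF => c0.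
by rewrite expr2 dvdp_mul2r ?pole_neq0 // dvd_pole.
Qed.

Lemma coprimep_pole x q : x != 0 -> coprimep (pole x) q = ~~ root q x^-1.
Proof.
move=> x0; rewrite pole_XsubC // coprimepZl ?oppr_eq0 //.
by rewrite coprimep_sym coprimep_XsubC.
Qed.

Lemma root_pole x y : x != 0 -> root (pole y) x^-1 = (x == y).
Proof.
move=> x0; rewrite rootE horner_pole subr_eq0 -(inj_eq (mulfI x0)).
by rewrite mulr1 mulrA divff // mul1r.
Qed.

Lemma deriv_pole x : (pole x)^`() = - x%:P.
Proof. by rewrite /pole derivB derivM derivX derivC -polyC1 derivC; ring. Qed.

Lemma dvd_simple_pole x q : x != 0 -> q.[x^-1] != 0 ->
  pole x %| 1 - (q.[x^-1]^-1)%:P * q.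
Proof.
move=> x0 qx; rewrite dvd_pole // rootE hornerD hornerN hornerM !hornerC.
by rewrite mulVf // subrr.
Qed.

(** The multiplier is the first-order Taylor expansion of 1/q at y = 1/x, namely 1/q(y) - (t - y)
    q'(y)/q(y)^2, where t - y is [pole x] divided by -x. *)
Lemma dvd_double_pole x q : x != 0 -> q.[x^-1] != 0 ->
  pole x ^+ 2 %|
    1 - ((x^-1 * (q^`().[x^-1] / q.[x^-1] ^+ 2))%:P * pole x +
         (q.[x^-1]^-1)%:P) * q.
Proof.
move=> x0 qx; apply: dvd_pole2 => //; rewrite rootE.
  rewrite !(horner_pole, hornerD, hornerN, hornerM, hornerC) mulVf // subrr.
  by rewrite mulr0 add0r mulVf // subrr.
rewrite derivB derivM derivD derivM deriv_pole -polyC1 !derivC.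
rewrite !(horner_pole, hornerD, hornerN, hornerM, hornerC) mulVf // subrr.
by apply/eqP; field; rewrite qx.
Qed.

Lemma size_pole x : x != 0 -> size (pole x) = 2%N.
Proof. by move=> x0; rewrite pole_XsubC // size_scale ?oppr_eq0 // size_XsubC. Qed.

Lemma size_pole_exp x n : x != 0 -> size (pole x ^+ n) = n.+1.
Proof.
move=> x0; rewrite -[LHS]prednK ?size_exp ?size_pole ?mul1n //.
by rewrite size_poly_gt0 expf_neq0 // pole_neq0.
Qed.

Variables (I : finType) (x : I -> K) (double : pred I).
Hypotheses (x_inj : injective x) (x_neq0 : forall i, x i != 0).

(** The boolean [double j] counts as 0 or 1, so the exponent is the order of the pole and both kinds
    are treated at once. *)
Definition pole_cofactor i : {poly K} :=
  \prod_(j | j != i) pole (x j) ^+ (double j).+1.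
(* The principal part at the node i is residue i / pole (x i) for a simple pole
   and residue2 i / pole (x i) + residue i / pole (x i) ^+ 2 for a double one. *)
Definition residue i : K := (pole_cofactor i).[(x i)^-1]^-1.
Definition residue2 i : K :=
  (x i)^-1 *
  ((pole_cofactor i)^`().[(x i)^-1] / (pole_cofactor i).[(x i)^-1] ^+ 2).

Lemma pole_cofactor_neq0 i : (pole_cofactor i).[(x i)^-1] != 0.
Proof.
rewrite horner_prod; apply/prodf_neq0 => j nji.
rewrite horner_exp expf_neq0 // -rootE root_pole //.
by apply: contraNneq nji => /x_inj->.
Qed.

(** Writing 1 as the sum of p_i times its cofactor, the error modulo ['X^n] is the sum of the
    cofactors times the errors of the separate expansions of the principal parts. *)
Lemma expands_poles (i0 : I) :
  expands 1 (\prod_i pole (x i) ^+ (double i).+1)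
    (fun n => \sum_i ((if double i then residue2 i else 0) +
      (if double i then n.+1 else 1)%:R * residue i) * x i ^+ n).
Proof.
pose p i := if double i then (residue2 i)%:P * pole (x i) + (residue i)%:P
  else (residue i)%:P.
pose s i n := ((if double i then residue2 i else 0) +
      (if double i then n.+1 else 1)%:R * residue i) * x i ^+ n.
have e i : expands (p i) (pole (x i) ^+ (double i).+1) (s i).
  rewrite /p /s; case: (double i); first exact: expands_double_pole.
  by rewrite expr1 add0r mul1r; apply: expands_pole.
have pf : \sum_i p i * pole_cofactor i = 1.
  apply: (@partial_fractions _ _ _ _ i0) => [i j nij||i|i].
  - rewrite coprimep_expl // coprimep_expr // coprimep_pole // root_pole //.
    by apply: contraNneq nij => /x_inj->.
  - by rewrite size_pole_exp //.
  - rewrite size_pole_exp // /p; case: (double i) => /=.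
      apply: leq_ltn_trans (size_polyD _ _) _; rewrite gtn_max.
      rewrite !(leq_ltn_trans (size_polyC_leq1 _)) // andbT.
      apply: leq_ltn_trans (size_polyMleq _ _) _; rewrite size_pole //.
      by have := size_polyC_leq1 (residue2 i); lia.
    exact: leq_ltn_trans (size_polyC_leq1 _) _.
  rewrite -/(pole_cofactor i) /p; have nz := pole_cofactor_neq0 i.
  case: (double i); first exact: dvd_double_pole.
  by rewrite expr1; apply: dvd_simple_pole.
move=> n; pose S i := \poly_(k < n) s i k.
have -> : \poly_(k < n) (\sum_i s i k) = \sum_i S i.
  apply/polyP => k; rewrite coef_sum coef_poly.
  under [RHS]eq_bigr => i _ do rewrite coef_poly.
  by case: ifP => // _; rewrite big1.
rewrite -[X in X - _]pf mulr_sumr -sumrB; apply: dvdp_sum => i _.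
rewrite [X in X * S i](bigD1 i) //= -/(pole_cofactor i).
rewrite [X in _ %| X](_ : _ = pole_cofactor i *
  (p i - pole (x i) ^+ (double i).+1 * S i)); last by ring.
by rewrite dvdp_mull // e.
Qed.

End Poles.

(** * Regularity of the residues *)

Section GeneratingCoefficients.
Variables (K : fieldType) (N : nat) (x : 'I_N -> K) (s : nat -> K).

(** The coefficient is the complete homogeneous symmetric polynomial of degree [n] in the [x i],
    read off a product of geometric series; truncating each after degree [n] does not affect it. *)
Lemma expands_prod_pole n :
  expands 1 (\prod_i pole (x i)) s ->
  s n = \sum_(f : {ffun 'I_N -> 'I_n.+1} | (\sum_i f i == n)%N)
          \prod_i x i ^+ f i.
Proof.
move=> e.
pose P : {poly K} := \prod_i \sum_(k < n.+1) (x i ^+ k) *: 'X^k.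
have q0 : (\prod_i pole (x i))`_0 != 0.
  rewrite -horner_coef0 horner_prod; apply/prodf_neq0 => i _.
  by rewrite horner_coef0 pole_coef0 oner_neq0.
rewrite (expands_coef (u := P) q0 e _ (leqnn n.+1)); last first.
  rewrite /P -big_split /=.
  elim/big_ind: _ => [|p q dp dq|i _].
  - by rewrite subrr dvdp0.
  - rewrite [X in _ %| X](_ : _ = (1 - p) + p * (1 - q)); last by ring.
    by rewrite dvdp_add // dvdp_mull.
  have := expands_pole 1 (x i) n.+1; rewrite poly_def polyC1.
  congr (is_true (_ %| 1 - _ * _)).
  by apply: eq_bigr => k _; rewrite mul1r.
rewrite /P bigA_distr_bigA coef_sum [RHS]big_mkcond; apply: eq_bigr => f _ /=.
rewrite scaler_prod prodrXr coefZ coefXn eq_sym.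
by case: eqP; rewrite ?mulr1 ?mulr0.
Qed.

End GeneratingCoefficients.

(** The quotient rule does not depend on the chosen fraction: differentiate the cross-multiplied
    identity between [p / q] and the reduced form. *)
Lemma ratderiv_div (K : fieldType) (p q : {poly K}) : q != 0 ->
  ratderiv (p%:F / q%:F) = (p^`() * q - p * q^`())%:F / (q ^+ 2)%:F.
Proof.
move=> q0; set r := _ / _; have d0 := ratden_neq0 r.
have rd : ratnum r * q = p * ratden r := ratnumM p q0.
have rd' := congr1 (@deriv K) rd; rewrite !derivM in rd'.
rewrite /ratderiv -!tofracM -tofracB -tofracXn; apply/eqP.
rewrite eqr_div ?tofrac_eq0 ?expf_neq0 // -!tofracM tofrac_eq; apply/eqP.
set n := ratnum r in rd rd' *; set d := ratden r in rd rd' *.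
have -> : (n^`() * d - n * d^`()) * q ^+ 2 =
  d * q * (n^`() * q + n * q^`()) - n * q * (q * d^`() + d * q^`()) by ring.
by rewrite rd' rd; ring.
Qed.

(* S stands for the ring of fractions regular at z = 0. *)
Section RegularPoles.
Variables (L : fieldType) (S : L -> Prop) (z : L).
Hypotheses (S0 : S 0) (S1 : S 1) (Sz : S z) (SN : forall r, S r -> S (- r)).
Hypothesis SD : forall r r', S r -> S r' -> S (r + r').
Hypothesis SM : forall r r', S r -> S r' -> S (r * r').
Hypothesis S_inv_sub1 : forall m, (0 < m)%N -> S (1 - z ^+ m)^-1.
Hypothesis z_neq0 : z != 0.
Hypothesis sub1X_neq0 : forall m, (0 < m)%N -> 1 - z ^+ m != 0.

Lemma S_exp m : S (z ^+ m).
Proof. by elim: m => [|m IHm]; rewrite ?exprS //; apply: SM. Qed.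

Lemma powers_inj : injective (GRing.exp z).
Proof.
have lt_neq m n : (m < n)%N -> z ^+ m != z ^+ n.
  move=> lt_mn; have := mulf_neq0 (sub1X_neq0 (m := n - m) _) (expf_neq0 m z_neq0).
  by rewrite subn_gt0 mulrBl mul1r -exprD subnK ?(ltnW lt_mn) // subr_eq0; apply.
move=> m n eq_mn; case: (ltngtP m n) => // [/lt_neq|/lt_neq]; by rewrite eq_mn eqxx.
Qed.

(* y times the logarithmic derivative controls the coefficients at double poles,
   and turns products into sums. *)
Definition regular_at (y : L) (q : {poly L}) :=
  [/\ q.[y] != 0, S q.[y]^-1 & S (y * (q^`().[y] / q.[y]))].

Lemma regular_at1 y : regular_at y 1.
Proof.
have e1 : (1 : {poly L}).[y] = 1 by exact: hornerC.
have d1 : (1 : {poly L})^`() = 0 by exact: derivC.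
split; rewrite ?d1 ?e1; first exact: oner_neq0.
  by rewrite invr1; apply: S1.
by rewrite horner0 mul0r mulr0; apply: S0.
Qed.

Lemma regular_atM y p q : regular_at y p -> regular_at y q -> regular_at y (p * q).
Proof.
move=> [p0 rp rp'] [q0 rq rq']; split; rewrite ?derivM ?hornerD !hornerM.
- by rewrite mulf_neq0.
- by rewrite invfM; apply: SM.
have := SD rp' rq'; congr S; field.
by rewrite p0 q0.
Qed.

Lemma regular_at_prod y (I : finType) (P : pred I) (q : I -> {poly L})
    (m : I -> nat) :
  (forall i, P i -> regular_at y (q i)) ->
  regular_at y (\prod_(i | P i) q i ^+ m i).
Proof.
move=> rq; apply: (big_ind (regular_at y)) => [||i Pi].
- exact: regular_at1.
- exact: regular_atM.
elim: (m i) => [|k IHk]; first by rewrite expr0; apply: regular_at1.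
by rewrite exprS; apply: regular_atM => //; apply: rq.
Qed.

(** The value 1 - z^(m - n) has a pole at z = 0, so its inverse is divisible by z^(n - m); one
    factor [z] is displayed for [residues_dvd_z]. *)
Lemma inv_horner_pole_lt m n : (m < n)%N ->
  (pole (z ^+ m)).[(z ^+ n)^-1]^-1 = z * (- z ^+ (n - m).-1 * (1 - z ^+ (n - m))^-1).
Proof.
move=> lt_mn; rewrite horner_pole.
have := sub1X_neq0 (m := n - m); rewrite subn_gt0 => /(_ lt_mn) h.
have z0 := expf_neq0 m z_neq0.
rewrite mulNr mulrN mulrA -exprS prednK ?subn_gt0 //.
rewrite -[in LHS](subnK (ltnW lt_mn)) exprD invfM -mulrA.
rewrite [_^-1 * z ^+ m]mulVf // mulr1.
have zn0 := expf_neq0 (n - m) z_neq0.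
move: (z ^+ (n - m)) h zn0 => w h w0; field.
by rewrite w0 h /= -opprB oppr_eq0 h.
Qed.

(** The scaled logarithmic derivative is -z^(m - n)/(1 - z^(m - n)), which for m < n equals 1/(1 -
    z^(n - m)); it is regular in both cases. *)
Lemma regular_at_pole m n : m != n -> regular_at (z ^+ n)^-1 (pole (z ^+ m)).
Proof.
move=> nmn; have z0 k := expf_neq0 k z_neq0; split.
- by rewrite -rootE root_pole //; apply: contraNneq nmn => /powers_inj->.
- case: (ltngtP m n) nmn => // [lt_mn|lt_nm] _.
    rewrite inv_horner_pole_lt //; apply: SM; first exact: Sz.
    apply: SM; first by apply: SN; apply: S_exp.
    by apply: S_inv_sub1; rewrite subn_gt0.
  rewrite horner_pole -[in z ^+ m](subnK (ltnW lt_nm)) exprD mulrC mulfK //.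
  by apply: S_inv_sub1; rewrite subn_gt0.
rewrite deriv_pole hornerN hornerC horner_pole.
case: (ltngtP m n) nmn => // [lt_mn|lt_nm] _.
  have : (0 < n - m)%N by rewrite subn_gt0.
  rewrite -[in z ^+ n](subnK (ltnW lt_mn)) exprD => m0.
  have := S_inv_sub1 m0; congr S.
  have := sub1X_neq0 m0; have := z0 m; have := z0 (n - m)%N.
  move: (z ^+ _) (z ^+ _) => w v w0 v0 w1; field.
  by rewrite w1 w0 v0 -opprB oppr_eq0 w1.
have : (0 < m - n)%N by rewrite subn_gt0.
rewrite -[in z ^+ m](subnK (ltnW lt_nm)) exprD => m0.
have := SN (SM (S_exp (m - n)) (S_inv_sub1 m0)).
congr S; have := sub1X_neq0 m0; have := z0 n.
by move: (z ^+ _) (z ^+ _) => v w v0 w1; field; rewrite w1 v0.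
Qed.

Variables (I : finType) (e : I -> nat) (double : pred I).
Hypothesis e_inj : injective e.
Local Notation x := (fun i => z ^+ e i).

Lemma regular_at_prod_pole (i : I) (P : pred I) (m : I -> nat) :
  (forall j, P j -> j != i) ->
  regular_at (x i)^-1 (\prod_(j | P j) pole (x j) ^+ m j).
Proof.
move=> Pi; apply: regular_at_prod => j Pj; apply: regular_at_pole.
by apply: contraNneq (Pi j Pj) => /e_inj->.
Qed.

Lemma residue2E i : residue2 x double i = residue x double i *
  ((x i)^-1 * ((pole_cofactor x double i)^`().[(x i)^-1] /
               (pole_cofactor x double i).[(x i)^-1])).
Proof.
rewrite /residue2 /residue; move: (_^-1) => y.
by move: (horner _ _) (horner _ _) => u v; rewrite expr2 invfM; ring.
Qed.

Lemma S_residues i : S (residue x double i) /\ S (residue2 x double i).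
Proof.
have [_ r1 r2] := @regular_at_prod_pole i (fun j => j != i)
  (fun j => (double j).+1) (fun j h => h).
by split; rewrite ?residue2E //; apply: SM.
Qed.

(** A node of smaller exponent contributes a factor [z] to the residue; [residue2] inherits it,
    being the residue times a regular logarithmic derivative. *)
Lemma residues_dvd_z i j : (e j < e i)%N ->
  exists r r', [/\ S r, S r', residue x double i = z * r &
                   residue2 x double i = z * r'].
Proof.
move=> lt_ji; have nji : j != i by apply: contraTneq lt_ji => ->; rewrite ltnn.
have [_ _ r2] := @regular_at_prod_pole i (fun j => j != i)
  (fun j => (double j).+1) (fun j h => h).
have [_ ro _] := @regular_at_prod_pole i (fun k => (k != i) && (k != j))
  (fun j => (double j).+1) (fun k h => proj1 (andP h)).
(* One copy of the factor at [j] supplies [z]; for a double node a second copy remains, and it only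
   has to be regular. *)
have [_ rj _] : regular_at (x i)^-1 (pole (x j) ^+ double j).
  case: (double j); rewrite ?expr1 ?expr0; last exact: regular_at1.
  by apply: regular_at_pole; rewrite ltn_eqF.
pose r := - z ^+ (e i - e j).-1 * (1 - z ^+ (e i - e j))^-1 *
  ((pole (x j) ^+ double j).[(x i)^-1]^-1 *
   (\prod_(k | (k != i) && (k != j)) pole (x k) ^+ (double k).+1).[(x i)^-1]^-1).
have Sr : S r.
  apply: (SM _ (SM rj ro)); apply: SM; first exact/SN/S_exp.
  by apply: S_inv_sub1; rewrite subn_gt0.
have rE : residue x double i = z * r.
  rewrite /residue /pole_cofactor (bigD1 j) //= exprS !hornerM !invfM.
  by rewrite inv_horner_pole_lt // /r; ring.
exists r; exists (r * ((x i)^-1 * ((pole_cofactor x double i)^`().[(x i)^-1] /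
               (pole_cofactor x double i).[(x i)^-1]))).
by split=> //; [exact: SM|rewrite residue2E rE -mulrA].
Qed.

End RegularPoles.

(** * Residues at powers of z as fractions regular at z = 0 *)

Section Regularity.
Variable K : fieldType.
Local Notation z := (zvar K).
Local Notation L := {fraction {poly K}}.

Lemma zvar_neq0 : z != 0.
Proof. by rewrite tofrac_eq0 polyX_eq0. Qed.

Lemma zvarXn n : z ^+ n = ('X^n)%:F.
Proof. by rewrite /zvar tofracXn. Qed.

Lemma regular_zvar n : regular (z ^+ n).
Proof. by rewrite zvarXn; apply: regular_poly. Qed.

Lemma sub1_zvar_neq0 m : (0 < m)%N -> 1 - z ^+ m != 0.
Proof.
move=> m0; rewrite zvarXn -tofrac1 -tofracB coef0_neq0 //.
by rewrite coefB coef1 coefXn (ltn_eqF m0) subr0 oner_neq0.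
Qed.

Lemma regular_inv_sub1 m : (0 < m)%N -> regular (1 - z ^+ m)^-1.
Proof.
move=> m0; exists 1, (1 - 'X^m).
rewrite coefB coef1 coefXn (ltn_eqF m0) subr0 oner_neq0; split=> //.
by rewrite zvarXn tofracB tofrac1 div1r.
Qed.

Lemma regular1 : regular (1 : L).
Proof. by rewrite -tofrac1; apply: regular_poly. Qed.

Lemma regular0 : regular (0 : L).
Proof. by rewrite -tofrac0; apply: regular_poly. Qed.

Section Nodes.
Variables (I : finType) (e : I -> nat) (double : pred I).
Hypothesis e_inj : injective e.
Local Notation x := (fun i => z ^+ e i).

Lemma regular_residues i :
  regular (residue x double i) /\ regular (residue2 x double i).
Proof.
apply: (S_residues regular0 regular1 (regular_zvar 1)) e_inj _.
- exact: regularN.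
- exact: regularD.
- exact: regularM.
- exact: regular_inv_sub1.
- exact: zvar_neq0.
exact: sub1_zvar_neq0.
Qed.

Lemma ratseries_residues_coef0 i j p : (e j < e i)%N ->
  ratseries (p%:F * residue x double i) 0 = 0 /\
  ratseries (p%:F * residue2 x double i) 0 = 0.
Proof.
move=> lt_ji.
have [] := @residues_dvd_z L (@regular K) z regular0 regular1 (regular_zvar 1)
  (@regularN K) (@regularD K) (@regularM K) regular_inv_sub1 zvar_neq0
  sub1_zvar_neq0 I e double e_inj i j lt_ji.
move=> r [r' [Sr Sr' -> ->]]; rewrite !mulrA ![p%:F * z]mulrC -!mulrA.
split; apply: (ratseries_XnM 1 0); apply: regularM => //; exact: regular_poly.
Qed.
End Nodes.

End Regularity.

(** * The poles of F *)

Section JointPoles.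
Variables (K : numFieldType) (d1 a : nat).
Hypothesis a_gt0 : (0 < a)%N.
Local Notation d2 := (d1 + 2 * a)%N.
Local Notation z := (zvar K).
Local Notation L := {fraction {poly K}}.

Definition double_pole (i : 'I_d2.+1) : bool := (a <= i <= a + d1)%N.
Definition node (i : 'I_d2.+1) : L := z ^+ (2 * i).

Lemma big_double_pole (R : Type) (idx : R) (op : Monoid.com_law idx)
    (g : nat -> R) :
  \big[op/idx]_(i < d2.+1 | double_pole i) g i =
  \big[op/idx]_(0 <= j < d1.+1) g (a + j)%N.
Proof.
rewrite -(big_mkord (fun i => a <= i <= a + d1)%N) (big_cat_nat _ (n := a)) //=;
  last by lia.
rewrite big_nat_cond big1 ?Monoid.mul1m => [|i]; last by lia.
rewrite (big_cat_nat _ (n := a + d1.+1)) //=; [|lia|lia].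
rewrite [X in op _ X]big_nat_cond [X in op _ X]big1 ?Monoid.mulm1 => [|i];
  last by lia.
rewrite -{1}[a]add0n big_addn addKn big_nat_cond [RHS]big_nat_cond.
apply: eq_big => [i|i _]; last by rewrite addnC.
by rewrite leq0n leq_addl addnC leq_add2l ltnS andbb andbT.
Qed.

Lemma node_neq0 i : node i != 0.
Proof. exact/expf_neq0/zvar_neq0. Qed.

Lemma zvar_inj : injective (GRing.exp z).
Proof. by apply: powers_inj; [exact: zvar_neq0|exact: sub1_zvar_neq0]. Qed.

Lemma node_inj : injective node.
Proof. move=> i j /zvar_inj /eqP; rewrite eqn_pmul2l // => /eqP; exact: val_inj. Qed.

(** The exponents d2 - d1 + 2j = 2(a + j) coming from V_(d1) repeat those exponents 2i coming from
    V_(d2) with i = a + j, which produces the double poles. *)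
Lemma prod_var_exponent (R : comNzRingType) (g : nat -> R) :
  \prod_(v < d1.+1 + d2.+1) g (var_exponent v) =
  \prod_(i < d2.+1) g (2 * i)%N ^+ (double_pole i).+1.
Proof.
under [RHS]eq_bigr => i _ do rewrite exprS.
rewrite big_split /= mulrC big_split_ord /=; congr (_ * _); last first.
  by apply: eq_bigr => j _; rewrite /var_exponent (unsplitK (inr j)).
transitivity (\prod_(i < d2.+1 | double_pole i) g (2 * i)%N); last first.
  rewrite big_mkcond; apply: eq_bigr => i _.
  by case: (double_pole i); rewrite ?expr1 ?expr0.
rewrite (big_double_pole _ (fun i => g (2 * i)%N)) big_mkord.
apply: eq_bigr => j _; rewrite /var_exponent (unsplitK (inl j)).
by rewrite addKn -mulnDr.
Qed.

Lemma FE_var_exponent (M : fieldType) (t y : M) : y != 0 ->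
  F d1 d2 t y = (\prod_(v < d1.+1 + d2.+1) (1 - t * y ^+ var_exponent v))^-1.
Proof.
move=> y0; rewrite FE //; congr (_^-1); rewrite big_split_ord.
congr (_ * _); apply: eq_bigr => j _.
  rewrite /var_exponent (unsplitK (inl j)).
  by rewrite exprnP; congr (1 - _ * _ ^ _); lia.
by rewrite /var_exponent (unsplitK (inr j)).
Qed.

Lemma zvar2_neq0 : zvar2 K != 0.
Proof. by rewrite tofrac_eq0 polyC_eq0 zvar_neq0. Qed.

Lemma pole_tvar2 n : 1 - tvar2 K * zvar2 K ^+ n = (pole (z ^+ n))%:F.
Proof. by rewrite /pole tofracB tofrac1 tofracM polyC_exp tofracXn. Qed.

Lemma F_var_pole :
  F d1 d2 (tvar2 K) (zvar2 K) =
  (\prod_(v < d1.+1 + d2.+1) pole (z ^+ var_exponent v))%:F^-1.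
Proof.
rewrite (FE_var_exponent _ zvar2_neq0); congr (_^-1).
rewrite (rmorph_prod (@FracField.tofrac _)); apply: eq_bigr => v _.
exact: pole_tvar2.
Qed.

Definition F_denominator : {poly L} := \prod_i pole (node i) ^+ (double_pole i).+1.

Lemma F_node_pole : F d1 d2 (tvar2 K) (zvar2 K) = F_denominator%:F^-1.
Proof.
rewrite F_var_pole; congr (_%:F^-1).
exact: (prod_var_exponent (fun n => pole (z ^+ n))).
Qed.

End JointPoles.

(** * The coefficients of F *)

Lemma coef0_prod (R : comNzRingType) (I : finType) (p : I -> {poly R}) :
  (\prod_i p i)`_0 = \prod_i (p i)`_0.
Proof.
rewrite -horner_coef0 horner_prod.
by apply: eq_bigr => i _; rewrite horner_coef0.
Qed.

Lemma coef0_exp (R : comNzRingType) (p : {poly R}) n : (p ^+ n)`_0 = p`_0 ^+ n.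
Proof. by rewrite -!horner_coef0 horner_exp. Qed.

Lemma ratseries_inv (K : fieldType) (q : {poly K}) s n :
  q`_0 != 0 -> expands 1 q s -> ratseries q%:F^-1 n = s n.
Proof.
by move=> q0 e; rewrite -[_^-1]div1r -tofrac1; apply: expands_ratseries.
Qed.

Section SeriesOfF.
Variables (K : numFieldType) (d1 a : nat).
Hypothesis a_gt0 : (0 < a)%N.
Local Notation d2 := (d1 + 2 * a)%N.
Local Notation z := (zvar K).
Local Notation L := {fraction {poly K}}.

Definition F_coef (n : nat) : L := ratseries (F d1 d2 (tvar2 K) (zvar2 K)) n.

Lemma F_denominator_coef0 : (F_denominator K d1 a)`_0 != 0.
Proof.
rewrite coef0_prod; apply/prodf_neq0 => i _.
by rewrite coef0_exp pole_coef0 expr1n oner_neq0.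
Qed.

Lemma regular2_F : regular (F d1 d2 (tvar2 K) (zvar2 K)).
Proof.
rewrite F_node_pole //; exists 1, (F_denominator K d1 a).
by rewrite F_denominator_coef0 tofrac1 div1r.
Qed.

Lemma ratseries2_F n m :
  ratseries2 ((1 - zvar2 K ^+ 2) * F d1 d2 (tvar2 K) (zvar2 K)) n m =
  ratseries ((1 - z ^+ 2) * F_coef n) m.
Proof.
rewrite /ratseries2 /F_coef; congr (ratseries _ m).
have -> : 1 - zvar2 K ^+ 2 = ((1 - z ^+ 2)%:P)%:F.
  by rewrite /zvar2 -tofracXn -polyC_exp -tofrac1 -tofracB -polyC1 -polyCB.
exact: (ratseries_constM _ n regular2_F).
Qed.

(** The product is kept over all variables, with repeated factors unmerged, so that its terms match
    the monomials of degree [n]. *)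
Lemma F_coef_monomials n :
  F_coef n = (\sum_(f : {ffun 'I_(d1.+1 + d2.+1) -> 'I_n.+1} |
                    (\sum_i f i == n)%N)
               'X^(\sum_i var_exponent i * f i))%:F.
Proof.
have q0 : (\prod_(v < d1.+1 + d2.+1) pole (z ^+ var_exponent v))`_0 != 0.
  rewrite coef0_prod; apply/prodf_neq0 => i _.
  by rewrite pole_coef0 oner_neq0.
have := expands_div 1 q0; rewrite tofrac1 div1r => /(expands_prod_pole n) e.
rewrite /F_coef F_var_pole // e.
rewrite (rmorph_sum (@FracField.tofrac _)); apply: eq_bigr => f _.
under eq_bigr => i _ do rewrite -exprM.
by rewrite prodrXr zvarXn.
Qed.

Local Notation x := (@node K d1 a).
Local Notation dbl := (@double_pole d1 a).

Definition pole_coef n (i : 'I_d2.+1) : L :=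
  (if double_pole i then residue2 x dbl i else 0) +
  (if double_pole i then n.+1 else 1)%:R * residue x dbl i.

Lemma F_coef_poles n : F_coef n = \sum_i pole_coef n i * node K i ^+ n.
Proof.
rewrite /F_coef F_node_pole //.
have e := expands_poles dbl (@node_inj K d1 a) (@node_neq0 K d1 a) ord0.
exact: (ratseries_inv n F_denominator_coef0 e).
Qed.

(** Applied with [w] equal to 0 and 2, this accounts for the two terms of 1 - z^2. *)
Lemma exponent_count_coef n w :
  (exponent_count d1 d2 n w)%:R =
  ('X^w * \sum_(f : {ffun 'I_(d1.+1 + d2.+1) -> 'I_n.+1} | (\sum_i f i == n)%N)
    'X^(\sum_i var_exponent i * f i) : {poly K})`_(n * d2).
Proof.
rewrite mulr_sumr coef_sum /exponent_count -sum1_card natr_sum.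
rewrite big_mkcond [RHS]big_mkcond; apply: eq_bigr => f _; rewrite inE.
case: ifP => [/andP[-> /eqP <-]|]; first by rewrite -exprD coefXn addnC eqxx.
case: ifP => //= _ /eqP nf; rewrite -exprD coefXn.
by case: eqP nf => // -> []; rewrite addnC.
Qed.

Lemma poincare_F n :
  poincare K d1 d2 n =
  Psi 1 d2 (ratseries2 ((1 - zvar2 K ^+ 2) * F d1 d2 (tvar2 K) (zvar2 K))) n.
Proof.
rewrite /Psi muln1 ratseries2_F F_coef_monomials.
have -> : 1 - z ^+ 2 = (1 - 'X^2)%:F by rewrite tofracB tofrac1 zvarXn.
rewrite -tofracM ratseries_poly mulrBl coefB mul1r.
have := exponent_count_coef n 0; rewrite mul1r => <-.
rewrite -(exponent_count_coef n 2) /poincare.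
by rewrite -(dim_joint_invariants K n (leq_addr _ _)) natrD addrK.
Qed.

End SeriesOfF.

(** * The residues of F *)

Lemma fraction_cancel_factor (M : fieldType) (r u : {fraction {poly M}})
    (p q d : {poly M}) m :
  r = d%:F^-1 -> u = p%:F -> p != 0 -> d = p ^+ m * q ->
  r * u ^+ m = 1%:F / q%:F.
Proof.
move=> -> -> p0 ->; rewrite -tofracXn tofracM tofrac1 div1r invfM mulrAC mulVf.
  by rewrite mul1r.
by rewrite tofrac_eq0 expf_neq0.
Qed.

Lemma rateval_ratderiv_inv (M : fieldType) (q : {poly M}) y : q.[y] != 0 ->
  rateval (ratderiv (1%:F / q%:F)) y = - (q^`().[y] / q.[y] ^+ 2).
Proof.
move=> qy; have q0 : q != 0 by apply: contraNneq qy => ->; rewrite horner0.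
rewrite (ratderiv_div _ q0) rateval_div horner_exp ?expf_neq0 //.
have -> : (1 : {poly M})^`() = 0 by exact: derivC.
by rewrite mul0r sub0r mul1r hornerN mulNr.
Qed.

Lemma phi_lt0 (M : fieldType) (m : int) (s : nat -> M) n :
  m < 0 -> phi m s n = 0.
Proof. by case: m. Qed.

Section Residues.
Variables (K : numFieldType) (d1 a : nat).
Hypothesis a_gt0 : (0 < a)%N.
Local Notation d2 := (d1 + 2 * a)%N.
Local Notation z := (zvar K).
Local Notation L := {fraction {poly K}}.
Local Notation x := (@node K d1 a).
Local Notation dbl := (@double_pole d1 a).
Local Notation cof := (pole_cofactor x dbl).

Let cof_neq0 (i : 'I_d2.+1) : (cof i).[(x i)^-1] != 0.
Proof. by apply: pole_cofactor_neq0; [exact: node_inj|exact: node_neq0]. Qed.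

Lemma F_mul_pole (i : 'I_d2.+1) :
  F d1 d2 (tvar2 K) (zvar2 K) *
    (1 - tvar2 K * zvar2 K ^+ (2 * i)%N) ^+ (double_pole i).+1 =
  1%:F / (cof i)%:F.
Proof.
apply: (fraction_cancel_factor (F_node_pole K d1 a_gt0) (pole_tvar2 K (2 * i))).
  exact: pole_neq0.
by rewrite /F_denominator (bigD1 i).
Qed.

Lemma rateval_F_mul_pole (i : 'I_d2.+1) :
  rateval (1%:F / (cof i)%:F) (x i)^-1 = residue x dbl i.
Proof.
rewrite (rateval_div _ (cof_neq0 i)) /residue -[RHS]div1r.
by congr (_ / _); apply: hornerC.
Qed.

Let zvar_expN n : z ^ (- n%:Z) = (z ^+ n)^-1.
Proof. by rewrite -invr_expz. Qed.

Lemma C_residue (i : 'I_d2.+1) : ~~ double_pole i ->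
  C d1 d2 K i = residue x dbl i.
Proof.
move=> ndi; have E := F_mul_pole i; rewrite (negPf ndi) expr1 in E.
rewrite -rateval_F_mul_pole -E.
exact: (congr1 (rateval _) (zvar_expN (2 * i))).
Qed.

Section DoublePole.
Variables (k : nat) (i : 'I_d2.+1).
Hypotheses (di : double_pole i) (ki : (k + i = d1 + a)%N).

Let e1 : d2%:Z + d1%:Z - (2 * k)%:Z = (2 * i)%N%:Z. Proof. lia. Qed.
Let e2 : (2 * k)%:Z - (d1%:Z + d2%:Z) = - (2 * i)%N%:Z. Proof. lia. Qed.

Let F_double :
  F d1 d2 (tvar2 K) (zvar2 K) *
    (1 - tvar2 K * zvar2 K ^ (d2%:Z + d1%:Z - (2 * k)%:Z)) ^+ 2 =
  1%:F / (cof i)%:F.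
Proof. by have E := F_mul_pole i; rewrite di in E; rewrite e1; exact: E. Qed.

Lemma B_residue : B d1 d2 K k = residue x dbl i.
Proof. by rewrite /B F_double e2 zvar_expN rateval_F_mul_pole. Qed.

(** The leading sign of [A] cancels the one from differentiating the inverse of the cofactor. *)
Lemma A_residue2 : A d1 d2 K k = residue2 x dbl i.
Proof.
rewrite /A F_double e1 e2 zvar_expN.
rewrite (rateval_ratderiv_inv (cof_neq0 i)) /residue2 /node.
by rewrite mulNr mulrN opprK.
Qed.

End DoublePole.

Let exp_inj : injective (fun i : 'I_d2.+1 => (2 * i)%N).
Proof. by move=> i j /eqP; rewrite eqn_pmul2l // => /eqP; exact: val_inj. Qed.

Let regular_sub1 (r : L) : regular r -> regular ((1 - z ^+ 2) * r).
Proof.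
apply: regularM; apply: regularD; first exact: regular1.
by apply/regularN/regular_zvar.
Qed.

Let regular_r (i : 'I_d2.+1) : regular (residue x dbl i).
Proof. by have [] := @regular_residues K _ _ dbl exp_inj i. Qed.

Let regular_r2 (i : 'I_d2.+1) : regular (residue2 x dbl i).
Proof. by have [] := @regular_residues K _ _ dbl exp_inj i. Qed.

Let natrL n : (n%:R : L) = ((n%:R)%:P)%:F.
Proof. by rewrite polyC_natr (rmorph_nat (@FracField.tofrac _)). Qed.

Lemma regular_pole_coef n (i : 'I_d2.+1) : regular (pole_coef K n i).
Proof.
rewrite /pole_coef natrL; apply: regularD.
  by case: ifP => _ //; apply: regular0.
by apply: regularM => //; apply: regular_poly.
Qed.

Lemma ratseries_pole_coef n m (i : 'I_d2.+1) :
  ratseries ((1 - z ^+ 2) * pole_coef K n i) m =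
  if double_pole i then ratseries ((1 - z ^+ 2) * residue2 x dbl i) m +
    n.+1%:R * ratseries ((1 - z ^+ 2) * residue x dbl i) m
  else ratseries ((1 - z ^+ 2) * residue x dbl i) m.
Proof.
rewrite /pole_coef; case: (double_pole i); last by rewrite add0r mul1r.
rewrite mulrDr (mulrCA _ n.+1%:R) natrL ratseriesD; [|exact: regular_sub1|].
  by rewrite ratseries_constM //; apply: regular_sub1.
by apply: regularM; [exact: regular_poly|exact: regular_sub1].
Qed.

(** Comparison with the node [ord0], of exponent 0 < 2i, gives a factor z in both residues. *)
Lemma ratseries_pole_coef0 n (i : 'I_d2.+1) : (0 < i)%N ->
  ratseries ((1 - z ^+ 2) * pole_coef K n i) 0 = 0.
Proof.
move=> i0; rewrite ratseries_pole_coef.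
have -> : 1 - z ^+ 2 = (1 - 'X^2)%:F by rewrite tofracB tofrac1 zvarXn.
have [|-> ->] := @ratseries_residues_coef0 K _ _ dbl exp_inj i ord0 (1 - 'X^2).
  by rewrite /= muln0 muln_gt0.
by rewrite mulr0 addr0 if_same.
Qed.

(** The power of the node shifts degrees by 2in, and n d2 - 2in = n(d2 - 2i) is the index read by
    [phi]. *)
Lemma F_coef_term n (i : 'I_d2.+1) :
  ratseries ((1 - z ^+ 2) * (pole_coef K n i * x i ^+ n)) (n * d2) =
  phi (d2%:Z - (2 * i)%:Z) (ratseries ((1 - z ^+ 2) * pole_coef K n i)) n.
Proof.
rewrite mulrA mulrC /node -exprM (zvarXn K (2 * i * n)) ratseries_XnM; last first.
  exact/regular_sub1/regular_pole_coef.
have [le_id|lt_di] := leqP (2 * i) d2.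
  rewrite mulnC leq_mul2l le_id orbT -mulnBr subzn //=.
rewrite phi_lt0; last by lia.
(* For n > 0 the shift exceeds n d2. For n = 0 there is no shift, and the constant term vanishes
   because d2 < 2i forces i > 0. *)
case: n => [|n] /=; last by rewrite mulnC leq_pmul2l // leqNgt lt_di.
rewrite muln0 mul0n ratseries_pole_coef0 ?if_same //; lia.
Qed.

Lemma regular_term n (i : 'I_d2.+1) :
  regular ((1 - z ^+ 2) * (pole_coef K n i * x i ^+ n)).
Proof.
apply/regular_sub1/regularM; first exact: regular_pole_coef.
by rewrite /node -exprM; apply: regular_zvar.
Qed.

(** Indexing by [nat] lets the sum over the poles be split into ranges and its middle range be
    reversed. *)
Definition pole_term n (i : nat) : K :=
  if (a <= i <= a + d1)%N then
    phi (d2%:Z - (2 * i)%:Z)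
      (ratseries ((1 - z ^+ 2) * A d1 d2 K (d1 + a - i))) n +
    n.+1%:R * phi (d2%:Z - (2 * i)%:Z)
      (ratseries ((1 - z ^+ 2) * B d1 d2 K (d1 + a - i))) n
  else phi (d2%:Z - (2 * i)%:Z) (ratseries ((1 - z ^+ 2) * C d1 d2 K i)) n.

Lemma Psi_pole_terms n :
  Psi 1 d2 (ratseries2 ((1 - zvar2 K ^+ 2) * F d1 d2 (tvar2 K) (zvar2 K))) n =
  \sum_(0 <= i < d2.+1) pole_term n i.
Proof.
rewrite /Psi muln1 ratseries2_F // F_coef_poles // mulr_sumr.
rewrite ratseries_sum => [|i _]; last exact: regular_term.
rewrite big_mkord; apply: eq_bigr => i _; rewrite F_coef_term /pole_term.
have := ratseries_pole_coef n ^~ i; rewrite -/(double_pole i).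
have [di|ndi] := boolP (double_pole i) => E.
  have ki : (d1 + a - i + i = d1 + a)%N by move: di; rewrite /double_pole; lia.
  rewrite (A_residue2 di ki) (B_residue di ki) /phi.
  by case: (_ - _) => m; rewrite ?E // mulr0 addr0.
rewrite (C_residue ndi) /phi.
by case: (_ - _) => m; rewrite ?E.
Qed.

Lemma sum_pole_terms n :
  \sum_(0 <= i < d2.+1) pole_term n i =
    \sum_(0 <= k < d1.+1 | (d1 <= 2 * k)%N)
      phi ((2 * k)%:Z - d1%:Z) (ratseries ((1 - z ^+ 2) * A d1 d2 K k)) n
    + \sum_(0 <= k < d1.+1 | (d1 <= 2 * k)%N)
      series_deriv (series_mulz
        (phi ((2 * k)%:Z - d1%:Z) (ratseries ((1 - z ^+ 2) * B d1 d2 K k)))) n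
    + \sum_(0 <= k < d2.+1 | (2 * k + d1 + 2 <= d2)%N)
      phi (d2%:Z - (2 * k)%:Z) (ratseries ((1 - z ^+ 2) * C d1 d2 K k)) n
    + \sum_(0 <= k < d2.+1 | (d1 + d2 + 2 <= 2 * k)%N)
      phi (d2%:Z - (2 * k)%:Z) (ratseries ((1 - z ^+ 2) * C d1 d2 K k)) n.
Proof.
rewrite (bigID (fun i => a <= i <= a + d1)%N) /= -!addrA addrA; congr (_ + _).
  (* Reversal turns the pole i = a + j into k = d1 - j, so that d2 - 2i = 2k - d1. The terms with 2k
     < d1 then have a negative [phi] index and vanish. *)
  rewrite big_mkord (big_double_pole d1 a_gt0 _ (pole_term n)) big_nat_rev /=.
  rewrite -big_split [RHS]big_mkcond big_nat [RHS]big_nat.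
  apply: eq_bigr => k /andP[_ lt_k]; rewrite /pole_term.
  have -> : (a <= a + (0 + d1.+1 - k.+1) <= a + d1)%N by lia.
  have -> : (d1 + a - (a + (0 + d1.+1 - k.+1)) = k)%N by lia.
  have -> : d2%:Z - (2 * (a + (0 + d1.+1 - k.+1)))%N%:Z = (2 * k)%:Z - d1%:Z by lia.
  case: ifP => // /negbT; rewrite -ltnNge => lt_kd.
  have lt0 : (2 * k)%:Z - d1%:Z < 0 by lia.
  by rewrite !phi_lt0 // mulr0 addr0.
(* The simple poles lie on both sides of the double range: i < a means 2i + d1 + 2 <= d2, and i > a
   + d1 means d1 + d2 + 2 <= 2i. *)
rewrite (bigID (fun i => i < a)%N) /=; congr (_ + _).
  rewrite big_nat_cond [RHS]big_nat_cond.
  apply: eq_big => [i|i]; first by apply/idP/idP; lia.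
  by rewrite /pole_term => /andP[_ /andP[/negPf-> _]].
rewrite big_nat_cond [RHS]big_nat_cond.
apply: eq_big => [i|i]; first by apply/idP/idP; lia.
by rewrite /pole_term => /andP[_ /andP[/negPf-> _]].
Qed.

End Residues.

Theorem theorem4 (R : realType) (d1 d2 : nat)
  (d1_gt0 : (0 < d1)%N) (d2_gt0 : (0 < d2)%N)
  (d12_parity : (d1 = d2 %[mod 2])%N) (d1_lt_d2 : (d1 < d2)%N) :
  let z : {fraction {poly R[i]}} := zvar R[i] in
  let F_tz : ratfun2 R[i] := F d1 d2 (tvar2 R[i]) (zvar2 R[i]) in
  let psiF := Psi 1 d2 (ratseries2 ((1 - zvar2 R[i] ^+ 2) * F_tz)) in
  poincare R[i] d1 d2 =1 psiF /\
  psiF =1 fun n =>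
    \sum_(0 <= k < d1.+1 | (d1 <= 2 * k)%N)
      phi ((2 * k)%:Z - d1%:Z) (ratseries ((1 - z ^+ 2) * A d1 d2 R[i] k)) n
    + \sum_(0 <= k < d1.+1 | (d1 <= 2 * k)%N)
      series_deriv (series_mulz
        (phi ((2 * k)%:Z - d1%:Z) (ratseries ((1 - z ^+ 2) * B d1 d2 R[i] k)))) n
    + \sum_(0 <= k < d2.+1 | (2 * k + d1 + 2 <= d2)%N)
      phi (d2%:Z - (2 * k)%:Z) (ratseries ((1 - z ^+ 2) * C d1 d2 R[i] k)) n
    + \sum_(0 <= k < d2.+1 | (d1 + d2 + 2 <= 2 * k)%N)
      phi (d2%:Z - (2 * k)%:Z) (ratseries ((1 - z ^+ 2) * C d1 d2 R[i] k)) n.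
Proof.
have [a da] : exists a, d2 = (d1 + 2 * a)%N by exists ((d2 - d1) %/ 2)%N; lia.
subst d2; have a_gt0 : (0 < a)%N by lia.
move=> z F_tz psiF; split=> n; first exact: poincare_F.
by rewrite -[RHS]sum_pole_terms //; apply: Psi_pole_terms.
Qed.
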